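(* Let $G$ be a discrete abelian group, $S=G\setminus\{0\}$, $p\in(1,\infty)$, and let $\mu_0,\mu_n\in\mathcal M$ $(n\in\mathbb N)$ be absolutely continuous with respect to $\lambda$, with $\mu_0\ll\mu_n$ for all $n\in\mathbb N$. Suppose $\mathrm{m}\text{-}\lim\mu_n=\mu_0$. If $\lim_{n\to\infty}\int|\phi_{\mu_0,p}(S)-\phi_{\mu_n,p}(S)|^p\,d\mu_0=0$, then $\lim_{n\to\infty}d_p(\mu_n;S)=d_p(\mu_0;S)$.
   Context: $G$ is a discrete abelian group (written additively, $G\ne\{0\}$), $\Gamma$ is its compact dual group with normalized Haar measure $\lambda$, and for $x\in G$, $e_x:\Gamma\to\mathbb C$ is the character of $\Gamma$ generated by $x$. $\mathcal M$ is the set of all non-zero finite non-negative regular Borel measures on $\Gamma$. For $S\subseteq G\setminus\{0\}$ non-empty, $\mathcal T(S)$ is the complex linear space of all finite sums $\sum_j a_je_{x_j}$, $a_j\in\mathbb C$, $x_j\in S$; $d_p(\mu;S):=\inf\{\int|1-\tau|^p\,d\mu:\tau\in\mathcal T(S)\}$; $[\mathcal T(S)]_{\mu,p}$ is the closure of $\mathcal T(S)$ in $L^p(\mu)$. For $p\in(1,\infty)$, the metric projection $\phi_{\mu,p}(S)$ is the unique element of $[\mathcal T(S)]_{\mu,p}$ with $\int|1-\phi_{\mu,p}(S)|^p\,d\mu=d_p(\mu;S)$. $\mathrm{m}\text{-}\lim\mu_n=\mu_0$ (convergence in measure) means: for some (equivalently, every) $\nu\in\mathcal M$ with $\mu_k\ll\nu$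 for all $k\in\mathbb N_0$, the Radon-Nikodym derivatives $\frac{d\mu_n}{d\nu}$ converge to $\frac{d\mu_0}{d\nu}$ in measure $\nu$. *)

(* Defs.v *)
From HB Require Import structures.
From mathcomp Require Import all_boot all_order all_algebra.
From mathcomp Require Import all_classical all_reals all_analysis.
From mathcomp Require Import complex.

Set Implicit Arguments.
Unset Strict Implicit.
Unset Printing Implicit Defensive.

Import Order.TTheory GRing.Theory Num.Theory.
Import numFieldNormedType.Exports.

Local Open Scope classical_set_scope.
Local Open Scope ring_scope.
Local Open Scope complex_scope.

(* The dual group of the discrete group G: all homomorphisms from G to the
   unit circle of R[i]. *)
Record dual_group (R : realType) (G : zmodType) := DualGroup {
  dual_fun :> G -> R[i];
  dual_funD : {morph dual_fun : x y / x + y >-> x * y};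
  dual_fun_norm : forall x, `|dual_fun x| = 1 }.

Section dual_group_structure.
Context {R : realType} {G : zmodType}.
Local Notation Gamma := (dual_group R G).

Lemma dual_oneD : {morph (fun _ : G => 1 : R[i]) : x y / x + y >-> x * y}.
Proof. by move=> x y; rewrite mulr1. Qed.

Lemma dual_one_norm (x : G) : `|1 : R[i]| = 1.
Proof. exact: normr1. Qed.

Definition dual_one : Gamma := DualGroup dual_oneD dual_one_norm.

Lemma dual_mulD (a b : Gamma) : {morph (fun x => a x * b x) : x y / x + y >-> x * y}.
Proof. by move=> x y; rewrite !dual_funD mulrACA. Qed.

Lemma dual_mul_norm (a b : Gamma) x : `|a x * b x| = 1.
Proof. by rewrite normrM !dual_fun_norm mulr1. Qed.

Definition dual_mul (a b : Gamma) : Gamma :=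
  DualGroup (dual_mulD a b) (dual_mul_norm a b).

HB.instance Definition _ := gen_eqMixin Gamma.
HB.instance Definition _ := gen_choiceMixin Gamma.
HB.instance Definition _ := isPointed.Build Gamma dual_one.

(* As G is discrete, its compact subsets are finite and the compact-open
   topology on Gamma is the topology of pointwise convergence. *)
HB.instance Definition _ := Topological.copy Gamma
  (initial_topology (@dual_fun R G : Gamma -> {ptws G -> R[i]^o})).

(* Gamma is measured by its Borel sigma-algebra. *)
HB.instance Definition _ := Measurable.copy Gamma
  (g_sigma_algebraType (@open Gamma)).

End dual_group_structure.

Section measures.
Context {R : realType} {G : zmodType}.
Local Notation Gamma := (dual_group R G).
Local Open Scope ereal_scope.

Definition regular_measure (mu : {measure set Gamma -> \bar R}) : Prop :=
  forall A : set Gamma, measurable A ->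
    mu A = ereal_sup [set mu K | K in [set K : set Gamma | compact K /\ K `<=` A]] /\
    mu A = ereal_inf [set mu U | U in [set U : set Gamma | open U /\ A `<=` U]].

(* Finiteness is carried by the type of mu. *)
Definition in_M (mu : {finite_measure set Gamma -> \bar R}) : Prop :=
  mu setT != 0 /\ regular_measure mu.

(* Being a probability makes the Haar measure normalized, hence unique. *)
Definition haar (lambda : probability Gamma R) : Prop :=
  regular_measure lambda /\
  forall (a : Gamma) (A : set Gamma), measurable A ->
    lambda (dual_mul a @` A) = lambda A.

Definition cvg_in_measure (nu : {measure set Gamma -> \bar R})
    (f : nat -> Gamma -> \bar R) (g : Gamma -> \bar R) : Prop :=
  forall e : R, (0 < e)%R ->
    nu [set x | e%:E <= `|f n x - g x|] @[n --> \oo] --> 0.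

Definition rn_derivative (mu nu : {finite_measure set Gamma -> \bar R}) :
    Gamma -> \bar R :=
  Radon_Nikodym (charge_of_finite_measure mu) nu.

Definition m_lim (mu : nat -> {finite_measure set Gamma -> \bar R})
    (mu0 : {finite_measure set Gamma -> \bar R}) : Prop :=
  exists nu : {finite_measure set Gamma -> \bar R},
    [/\ in_M nu, mu0 `<< nu, (forall n, mu n `<< nu) &
        cvg_in_measure nu (fun n => rn_derivative (mu n) nu)
          (rn_derivative mu0 nu)].

End measures.

Section prediction.
Context {R : realType} {G : zmodType}.
Local Notation Gamma := (dual_group R G).
Local Notation normc := ComplexField.Normc.normc.

Definition echar (x : G) : Gamma -> R[i] := fun gamma => gamma x.

Definition trig_poly (S : set G) : set (Gamma -> R[i]) :=
  [set tau | exists s : seq (R[i] * G), (forall u, u \in s -> S u.2) /\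
     tau = fun gamma => \sum_(u <- s) u.1 * echar u.2 gamma].

Definition pth_integral (mu : {measure set Gamma -> \bar R}) (p : R)
    (f : Gamma -> R[i]) : \bar R :=
  (\int[mu]_gamma (normc (f gamma) `^ p)%:E)%E.

Definition dist_p (mu : {measure set Gamma -> \bar R}) (p : R) (S : set G) :
    \bar R :=
  ereal_inf [set pth_integral mu p (fun gamma => 1 - tau gamma) |
    tau in trig_poly S].

Definition cmeasurable (f : Gamma -> R[i]) : Prop :=
  measurable_fun setT (fun gamma => complex.Re (f gamma)) /\
  measurable_fun setT (fun gamma => complex.Im (f gamma)).

(* Elements of L^p(mu) are given by representatives. *)
Definition in_Lp (mu : {measure set Gamma -> \bar R}) (p : R)
    (f : Gamma -> R[i]) : Prop :=
  cmeasurable f /\ finite_norm mu p%:E (fun gamma => normc (f gamma)).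

Definition Lp_closure (mu : {measure set Gamma -> \bar R}) (p : R)
    (V : set (Gamma -> R[i])) : set (Gamma -> R[i]) :=
  [set f | in_Lp mu p f /\ forall e : R, 0 < e -> exists2 tau, V tau &
     (Lnorm mu p%:E (fun gamma => (normc (f gamma - tau gamma))%:E) < e%:E)%E].

(* phi is a representative of the metric projection, which is unique up to
   mu-a.e. equality for 1 < p. *)
Definition metric_projection (mu : {measure set Gamma -> \bar R}) (p : R)
    (S : set G) (phi : Gamma -> R[i]) : Prop :=
  Lp_closure mu p (trig_poly S) phi /\
  pth_integral mu p (fun gamma => 1 - phi gamma) = dist_p mu p S.

End prediction.

(* Main.v *)
Require Import Defs.
From HB Require Import structures.
From mathcomp Require Import all_boot all_order all_algebra.
From mathcomp Require Import all_classical all_reals all_analysis.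
From mathcomp Require Import measurable_realfun complex.
From mathcomp Require Import ring lra.

Import Order.TTheory GRing.Theory Num.Theory.
Import numFieldNormedType.Exports.

Local Open Scope classical_set_scope.
Local Open Scope ring_scope.

(** Let phi be a metric projection for mu, let d be the distance and put
    z := 1 - phi. In the direction w, the p-th power of the modulus has at z
    the derivative p times [grad p z w], the real part of
    |z|^(p-2) z times the conjugate of w. Minimality of phi makes the integral
    of [grad p z w] against mu vanish for every w in the closure of T(S)
    ([integral_grad_eq0]). Taking w = phi, one finds that the integral of
    H := [grad p z 1] is that of [grad p z z] = |z|^p, namely d
    ([integral_grad1]). Taking for w the characters e_x with x nonzero, one
    finds that H mu has the same Fourier coefficients as d lambda. Hence
    H mu = d lambda as measures ([extremal_haar]), by orthogonality of the
    characters ([haar_orthogonal]) and by uniqueness of Fourier coefficients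
    of regular measures ([fourier_uniqueness]). The latter rests on an
    elementary construction of trigonometric polynomials that separate a
    compact set from the complement of an open one ([separated_compact]).

    Now let nu dominate all the measures, and let k_n := H_n dmu_n/dnu be the
    density of d_n lambda. All these densities are proportional,
    d_m k_n = d_n k_m ([ext_density_proportional]), and k_m vanishes mu0-almost
    nowhere as soon as d_m is nonzero, because mu0 is dominated by lambda
    ([ext_density_neq0]). If the distances d_n did not converge to d_0, some
    subsequence would stay away from d_0; on a further subsequence both phi_n
    and dmu_n/dnu converge mu0-almost everywhere, hence so does k_n. At a single
    point where this happens and k_m is nonzero, d_n = d_m k_n / k_m converges
    to d_m k_0 / k_m = d_0, a contradiction ([cvg_dist_p_separated]).

    Orthogonality of the characters holds when each nonzero x in G is moved by
    some character. Otherwise some e_x with x nonzero is the constant 1, and all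
    the distances are zero ([dist_p_eq0]). *)

Set Implicit Arguments.
Unset Strict Implicit.
Unset Printing Implicit Defensive.

Local Notation Re := complex.Re.
Local Notation Im := complex.Im.
Local Notation normc := ComplexField.Normc.normc.

(** * The derivative of the p-th power of the modulus *)

Section modulus.
Context {R : realType}.
Implicit Types (z w u : R[i]) (p : R).

Lemma normc_sqrtE z : normc z = Num.sqrt (Re z ^+ 2 + Im z ^+ 2).
Proof. by case: z. Qed.

Lemma normc_ge0 z : 0 <= normc z.
Proof. by rewrite normc_sqrtE sqrtr_ge0. Qed.

Lemma sqr_normc_ReIm z : normc z ^+ 2 = Re z ^+ 2 + Im z ^+ 2.
Proof. by rewrite normc_sqrtE sqr_sqrtr// addr_ge0 ?sqr_ge0. Qed.

Lemma normr_normc z : `|z| = (normc z)%:C%C.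
Proof. by rewrite normc_def normc_sqrtE. Qed.

Lemma normcD_le z w : normc (z + w) <= normc z + normc w.
Proof. exact: le_normcD. Qed.

Lemma normcB z w : normc (z - w) = normc (w - z).
Proof. by rewrite -normcN opprB. Qed.

Lemma normcB_le z w : normc (z - w) <= normc z + normc w.
Proof. by rewrite -(normcN w) normcD_le. Qed.

Lemma normc_real (t : R) : normc t%:C%C = `|t|.
Proof. by rewrite normc_sqrtE /= expr0n/= addr0 sqrtr_sqr. Qed.

Lemma normr_Re_le z : `|Re z| <= normc z.
Proof. by rewrite -(sqrtr_sqr (Re z)) normc_sqrtE ler_wsqrtr// lerDl sqr_ge0. Qed.

Lemma normr_Im_le z : `|Im z| <= normc z.
Proof. by rewrite -(sqrtr_sqr (Im z)) normc_sqrtE ler_wsqrtr// lerDr sqr_ge0. Qed.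

(** The real inner product of the plane, that is the real part of
    z times the conjugate of w. *)
Definition cdot z w : R := Re z * Re w + Im z * Im w.

Lemma cdotD z w u : cdot z (w + u) = cdot z w + cdot z u.
Proof. by rewrite /cdot !raddfD /=; ring. Qed.

Lemma cdotN z w : cdot z (- w) = - cdot z w.
Proof. by rewrite /cdot !raddfN /=; ring. Qed.

Lemma cdotZ z (t : R) w : cdot z (t%:C%C * w) = t * cdot z w.
Proof. by rewrite /cdot; case: w => a b /=; ring. Qed.

Lemma cdotzz z : cdot z z = normc z ^+ 2.
Proof. by rewrite sqr_normc_ReIm /cdot; ring. Qed.

Lemma cdot_le z w : `|cdot z w| <= normc z * normc w.
Proof.
rewrite -ler_sqr ?nnegrE ?mulr_ge0 ?normc_ge0//.
rewrite real_normK ?num_real// exprMn !sqr_normc_ReIm /cdot -subr_ge0.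
set a := Re z; set b := Im z; set c := Re w; set d := Im w.
suff -> : (a ^+ 2 + b ^+ 2) * (c ^+ 2 + d ^+ 2) - (a * c + b * d) ^+ 2 =
  (a * d - b * c) ^+ 2 by exact: sqr_ge0.
ring.
Qed.

(** Up to the factor p, the derivative of the p-th power of the modulus at z
    in the direction w. *)
Definition grad p z w : R := normc z `^ (p - 2) * cdot z w.

Lemma gradD p z w u : grad p z (w + u) = grad p z w + grad p z u.
Proof. by rewrite /grad cdotD mulrDr. Qed.

Lemma gradN p z w : grad p z (- w) = - grad p z w.
Proof. by rewrite /grad cdotN mulrN. Qed.

Lemma gradZ p z (t : R) w : grad p z (t%:C%C * w) = t * grad p z w.
Proof. by rewrite /grad cdotZ mulrCA. Qed.

Lemma grad_le p z w : 1 < p -> `|grad p z w| <= normc z `^ (p - 1) * normc w.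
Proof.
move=> p1; rewrite /grad normrM ger0_norm ?powR_ge0//.
apply: (le_trans (ler_wpM2l (powR_ge0 _ _) (cdot_le _ _))).
rewrite mulrA; apply: ler_wpM2r; first exact: normc_ge0.
have := normc_ge0 z; rewrite le_eqVlt => /predU1P[<-|z0].
  by rewrite mulr0 powR_ge0.
rewrite -[X in _ * X <= _](powRr1 (ltW z0)) -powRD ?(gt_eqF z0) ?implybT//.
rewrite (_ : p - 2 + 1 = p - 1) //; lra.
Qed.

Lemma gradzz p z : 1 < p -> grad p z z = normc z `^ p.
Proof.
move=> p1; rewrite /grad cdotzz.
have := normc_ge0 z; rewrite le_eqVlt => /predU1P[<-|z0].
  by rewrite expr0n/= mulr0 powR0// gt_eqF// (lt_trans ltr01).
rewrite -powR_mulrn ?(ltW z0)// -powRD ?(gt_eqF z0) ?implybT//.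
by rewrite subrK.
Qed.

(** Cauchy-Schwarz reduces this tangent inequality to the one for the real
    function x `^ p, which is Young's inequality. *)
Lemma normc_powR_convex p z u : 1 < p ->
  normc z `^ p + p * grad p z (u - z) <= normc u `^ p.
Proof.
move=> p1; have p0 : 0 < p by rewrite (lt_trans ltr01).
rewrite gradD gradN gradzz//.
have h := le_trans (ler_norm _) (grad_le z u p1).
have q0 : 0 < p / (p - 1) by rewrite divr_gt0// subr_gt0.
have p1N : p - 1 != 0 by rewrite subr_eq0 gt_eqF.
have pN : p != 0 by rewrite gt_eqF.
have pq : p^-1 + (p / (p - 1))^-1 = 1 by field; apply/andP.
have := conjugate_powR (normc_ge0 u) (powR_ge0 (normc z) (p - 1)) p0 q0 pq.
rewrite -powRrM.
have -> : (p - 1) * (p / (p - 1)) = p by field.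
have -> x : x / (p / (p - 1)) = x * ((p - 1) / p) by field; apply/andP.
move=> Y.
have Y2 : p * (normc u * normc z `^ (p - 1)) <=
          normc u `^ p + (p - 1) * normc z `^ p.
  apply: (le_trans (ler_wpM2l (ltW p0) Y)).
  by rewrite le_eqVlt; apply/orP; left; apply/eqP; field.
have := ler_wpM2l (ltW p0) h; rewrite (mulrC (_ `^ _)) => h2.
rewrite mulrDr mulrN; lra.
Qed.

End modulus.

Section grad_continuity.
Context {R : realType} (I : Type) (F : set_system I) {FF : Filter F}.

Lemma cvg_powR (f : I -> R) (l q : R) : 0 <= l -> (forall i, 0 <= f i) ->
  f i @[i --> F] --> l -> 0 < l \/ 0 < q -> f i `^ q @[i --> F] --> l `^ q.
Proof.
rewrite le_eqVlt => /predU1P[<-|l0] f0 fl.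
  case=> [|q0]; first by rewrite ltxx.
  rewrite powR0 ?gt_eqF//; apply/cvgrPdist_lt => e e0.
  have e1 : 0 < e `^ q^-1 by rewrite powR_gt0.
  move/cvgrPdist_lt/(_ _ e1) : fl; apply: filterS => i.
  rewrite !sub0r !normrN ger0_norm// ger0_norm ?powR_ge0// => h.
  have := gt0_ltr_powR q0 (f0 i) (powR_ge0 _ _) h.
  by rewrite -powRrM mulVf ?gt_eqF// powRr1 ?ltW.
move=> _.
apply: (@cvg_comp _ _ _ f (fun x : R => x `^ q) F (nbhs l)) => //.
apply: (@differentiable_continuous _ _ _ l (fun x : R => x `^ q)).
apply/derivable1_diffP/derivable_powR.
by rewrite in_itv/= l0.
Qed.

Lemma cvg_normcB_Re (z : I -> R[i]) (l : R[i]) :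
  normc (z i - l) @[i --> F] --> 0 -> Re (z i) @[i --> F] --> Re l.
Proof.
move/cvgrPdist_lt => zl; apply/cvgrPdist_lt => e /zl; apply: filterS => i.
rewrite sub0r normrN ger0_norm ?normc_ge0//; apply: le_lt_trans.
by rewrite distrC -raddfB normr_Re_le.
Qed.

Lemma cvg_normcB_Im (z : I -> R[i]) (l : R[i]) :
  normc (z i - l) @[i --> F] --> 0 -> Im (z i) @[i --> F] --> Im l.
Proof.
move/cvgrPdist_lt => zl; apply/cvgrPdist_lt => e /zl; apply: filterS => i.
rewrite sub0r normrN ger0_norm ?normc_ge0//; apply: le_lt_trans.
by rewrite distrC -raddfB normr_Im_le.
Qed.

Lemma cvg_normc (z : I -> R[i]) (l : R[i]) :
  normc (z i - l) @[i --> F] --> 0 -> normc (z i) @[i --> F] --> normc l.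
Proof.
move/cvgrPdist_lt => zl; apply/cvgrPdist_lt => e /zl; apply: filterS => i.
rewrite sub0r normrN ger0_norm ?normc_ge0//; apply: le_lt_trans.
have h1 : normc (z i) <= normc (z i - l) + normc l.
  by rewrite -{1}(subrK l (z i)) normcD_le.
have h2 : normc l <= normc (z i - l) + normc (z i).
  by rewrite normcB -{1}(subrK (z i) l) normcD_le.
by rewrite ler_norml; apply/andP; split; lra.
Qed.

(** At the origin the factor [normc z `^ (p - 2)] may blow up, but the whole is
    bounded by [normc z `^ (p - 1)]. *)
Lemma cvg_grad (p : R) (z : I -> R[i]) (l w : R[i]) : 1 < p ->
  normc (z i - l) @[i --> F] --> 0 -> grad p (z i) w @[i --> F] --> grad p l w.
Proof.
move=> p1 zl.
have [l0|lN0] := eqVneq (normc l) 0.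
  have -> : grad p l w = 0.
    apply/eqP; rewrite -normr_le0 (le_trans (grad_le _ _ p1))// l0 powR0 ?mul0r//.
    by rewrite subr_eq0 gt_eqF.
  have B : (fun i => normc (z i) `^ (p - 1) * normc w) @ F --> 0.
    rewrite -(mul0r (normc w)); apply: cvgM; last exact: cvg_cst.
    have -> : (0 : R) = normc l `^ (p - 1).
      by rewrite l0 powR0// subr_eq0 gt_eqF.
    apply: cvg_powR; rewrite ?normc_ge0//.
    - by move=> i; exact: normc_ge0.
    - exact: cvg_normc.
    - by right; rewrite subr_gt0.
  move/cvgrPdist_lt : B => B; apply/cvgrPdist_lt => e /B; apply: filterS => i.
  rewrite !sub0r !normrN; apply: le_lt_trans.
  by rewrite (le_trans (grad_le _ _ p1))// ler_norm.
apply: cvgM.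
  apply: cvg_powR; rewrite ?normc_ge0//.
  - by move=> i; exact: normc_ge0.
  - exact: cvg_normc.
  - by left; rewrite lt_neqAle eq_sym lN0 normc_ge0.
by apply: cvgD; apply: cvgM; try exact: cvg_cst;
  [exact: cvg_normcB_Re|exact: cvg_normcB_Im].
Qed.

End grad_continuity.

(** * Complex-valued functions in L^p *)

Section Lp.
Context {R : realType} {G : zmodType}.
Local Notation Gamma := (dual_group R G).
Implicit Types (f g : Gamma -> R[i]).

Lemma cmeasurableD f g : cmeasurable f -> cmeasurable g ->
  cmeasurable (fun x => f x + g x).
Proof.
move=> [f1 f2] [g1 g2]; split.
- rewrite (_ : (fun x => Re (f x + g x)) = (fun x => Re (f x) + Re (g x))).
    exact: measurable_funD.
  by apply/funext => x; rewrite raddfD.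
- rewrite (_ : (fun x => Im (f x + g x)) = (fun x => Im (f x) + Im (g x))).
    exact: measurable_funD.
  by apply/funext => x; rewrite raddfD.
Qed.

Lemma cmeasurable_cst (c : R[i]) : cmeasurable (fun _ : Gamma => c).
Proof. by split; exact: measurable_cst. Qed.

Lemma cmeasurableM f g : cmeasurable f -> cmeasurable g ->
  cmeasurable (fun x => f x * g x).
Proof.
move=> [f1 f2] [g1 g2]; split.
- rewrite (_ : (fun x => Re (f x * g x)) =
    (fun x => Re (f x) * Re (g x) - Im (f x) * Im (g x))).
    by apply: measurable_funB; exact: measurable_funM.
  by apply/funext => x; case: (f x) (g x) => a b [c d].
- rewrite (_ : (fun x => Im (f x * g x)) =
    (fun x => Re (f x) * Im (g x) + Im (f x) * Re (g x))).
    by apply: measurable_funD; exact: measurable_funM.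
  by apply/funext => x; case: (f x) (g x) => a b [c d].
Qed.

Lemma cmeasurableB f g : cmeasurable f -> cmeasurable g ->
  cmeasurable (fun x => f x - g x).
Proof.
move=> mf mg; rewrite (_ : (fun x => _) = (fun x => f x + (-1) * g x)).
  by apply: cmeasurableD => //; apply: cmeasurableM => //; exact: cmeasurable_cst.
by apply/funext => x; rewrite mulN1r.
Qed.

Lemma measurable_normc f : cmeasurable f ->
  measurable_fun setT (fun x => normc (f x)).
Proof.
move=> [f1 f2].
rewrite (_ : (fun x => normc (f x)) =
  Num.sqrt \o (fun x => Re (f x) ^+ 2 + Im (f x) ^+ 2)); last first.
  by apply/funext => x /=; rewrite normc_sqrtE.
apply: measurableT_comp.
  by apply: continuous_measurable_fun; exact: sqrt_continuous.
by apply: measurable_funD; exact: measurable_funX.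
Qed.

Lemma measurable_normc_powR (p : R) f : cmeasurable f ->
  measurable_fun setT (fun x => normc (f x) `^ p).
Proof.
move=> mf; apply: (@measurableT_comp _ _ _ _ _ _ (@powR R ^~ p)) => //.
exact: measurable_normc.
Qed.

Lemma measurable_grad (p : R) f g : cmeasurable f -> cmeasurable g ->
  measurable_fun setT (fun x => grad p (f x) (g x)).
Proof.
move=> mf mg; apply: measurable_funM; first exact: measurable_normc_powR.
case: mf mg => f1 f2 [g1 g2].
by apply: measurable_funD; exact: measurable_funM.
Qed.

Variables (mu : {finite_measure set Gamma -> \bar R}) (p : R) (p1 : 1 < p).

Let p0 : 0 < p. Proof. by rewrite (lt_trans ltr01). Qed.

Local Notation nrm f := (Lnorm mu p%:E (fun x => (normc (f x))%:E)).

Lemma in_Lp_Lfun f : in_Lp mu p f -> (fun x => normc (f x)) \in Lfun mu p%:E.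
Proof.
move=> [mf nf]; rewrite inE; apply/andP; split; rewrite inE//=.
exact: measurable_normc.
Qed.

Lemma pth_integralE f : pth_integral mu p f = (nrm f `^ p)%E.
Proof.
rewrite powR_Lnorm ?gt_eqF//; apply: eq_integral => x _.
by rewrite abse_EFin poweR_EFin ger0_norm ?normc_ge0.
Qed.

Lemma integrable_pth f : in_Lp mu p f ->
  mu.-integrable setT (fun x => (normc (f x) `^ p)%:E).
Proof.
move=> /in_Lp_Lfun/(Lfun_integrable (ltW p1)).
by under eq_fun do rewrite ger0_norm ?normc_ge0//.
Qed.

Lemma Lnorm_normcD f g : cmeasurable f -> cmeasurable g ->
  (nrm (fun x => f x + g x) <= nrm f + nrm g)%E.
Proof.
move=> mf mg.
have := @minkowski_EFin _ _ _ mu _ _ p (measurable_normc mf)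
  (measurable_normc mg) (ltW p1).
apply: le_trans; rewrite unlock/=.
apply: gt0_ler_poweR; rewrite ?invr_ge0 ?(ltW p0)// ?in_itv/= ?leey ?andbT.
- by apply: integral_ge0 => x _; rewrite lee_fin powR_ge0.
- by apply: integral_ge0 => x _; rewrite lee_fin powR_ge0.
apply: ge0_le_integral => //=.
- apply/measurable_EFinP; apply: (@measurableT_comp _ _ _ _ _ _ (@powR R ^~ p)) => //.
  by apply: measurableT_comp => //; apply: measurable_normc; exact: cmeasurableD.
- apply/measurable_EFinP; apply: (@measurableT_comp _ _ _ _ _ _ (@powR R ^~ p)) => //.
  by apply: measurableT_comp => //; apply: measurable_funD; exact: measurable_normc.
move=> x _; rewrite lee_fin ge0_ler_powR ?nnegrE ?normr_ge0 ?(ltW p0)//.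
by rewrite !ger0_norm ?addr_ge0 ?normc_ge0// normcD_le.
Qed.

Lemma Lnorm_normcZ (c : R[i]) f : cmeasurable f ->
  nrm (fun x => c * f x) = ((normc c)%:E * nrm f)%E.
Proof.
move=> mf; rewrite unlock/=.
under eq_integral.
  move=> x _; rewrite ComplexField.Normc.normcM normrM powRM//.
  rewrite EFinM ger0_norm ?normc_ge0//; over.
rewrite ge0_integralZl_EFin ?powR_ge0//; last first.
  apply/measurable_EFinP.
  apply: (@measurableT_comp _ _ _ _ _ _ (@powR R ^~ p)) => //.
  by apply: measurableT_comp => //; exact: measurable_normc.
rewrite poweRM ?lee_fin ?powR_ge0//; last first.
  by apply: integral_ge0 => x _; rewrite lee_fin powR_ge0.
congr (_ * _)%E.
by rewrite poweR_EFin -powRrM mulfV ?gt_eqF// powRr1 ?normc_ge0.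
Qed.

Lemma in_LpD f g : in_Lp mu p f -> in_Lp mu p g ->
  in_Lp mu p (fun x => f x + g x).
Proof.
move=> [mf nf] [mg ng]; split; first exact: cmeasurableD.
by apply: (le_lt_trans (Lnorm_normcD mf mg)); rewrite lte_add_pinfty.
Qed.

Lemma in_LpZ (c : R[i]) f : in_Lp mu p f -> in_Lp mu p (fun x => c * f x).
Proof.
move=> [mf nf]; split; first exact: (cmeasurableM (cmeasurable_cst c)).
rewrite /finite_norm (_ : EFin \o _ = fun x => (normc (c * f x))%:E)//.
by rewrite Lnorm_normcZ// lte_mul_pinfty ?lee_fin ?normc_ge0.
Qed.

Lemma in_Lp_bounded (M : R) f : cmeasurable f -> (forall x, normc (f x) <= M) ->
  in_Lp mu p f.
Proof.
move=> mf fM; split=> //; rewrite /finite_norm unlock/= poweR_lty//.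
apply: (@le_lt_trans _ _ (\int[mu]_x (cst (M `^ p) x)%:E)%E); last first.
  by apply: integrable_lty => //; exact: finite_measure_integrable_cst.
apply: ge0_le_integral => //=.
- apply/measurable_EFinP.
  apply: (@measurableT_comp _ _ _ _ _ _ (@powR R ^~ p)) => //.
  by apply: measurableT_comp => //; exact: measurable_normc.
move=> x _; rewrite lee_fin ge0_ler_powR ?nnegrE ?normr_ge0 ?(ltW p0)//.
  exact: le_trans (normc_ge0 _) (fM x).
by rewrite ger0_norm ?normc_ge0.
Qed.

Lemma in_Lp_cst (c : R[i]) : in_Lp mu p (fun=> c).
Proof. exact: (@in_Lp_bounded (normc c) _ (cmeasurable_cst c)). Qed.

Lemma in_LpB f g : in_Lp mu p f -> in_Lp mu p g ->
  in_Lp mu p (fun x => f x - g x).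
Proof.
move=> lf lg; rewrite (_ : (fun x => _) = (fun x => f x + (-1) * g x)).
  by apply: in_LpD => //; exact: in_LpZ.
by apply/funext => x; rewrite mulN1r.
Qed.

(** A majorant for dominated convergence: when z is moved by at most the length
    of w, it increases at most to (|z| + 2 |w|)^p. *)
Lemma normr_grad_le (z w : R[i]) : `|grad p z w| <= (normc z + normc w) `^ p.
Proof.
apply: (le_trans (grad_le _ _ p1)).
have s0 : 0 <= normc z + normc w by rewrite addr_ge0 ?normc_ge0.
rewrite -(mulr_powRB1 s0 p0) mulrC; apply: ler_pM;
  rewrite ?normc_ge0 ?powR_ge0 ?lerDr ?normc_ge0//.
by rewrite ge0_ler_powR ?nnegrE ?normc_ge0 ?subr_ge0 ?(ltW p1)// lerDl normc_ge0.
Qed.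

Lemma integrable_addnormc f g : in_Lp mu p f -> in_Lp mu p g ->
  mu.-integrable setT (fun x => ((normc (f x) + normc (g x)) `^ p)%:E).
Proof.
move=> /in_Lp_Lfun lf /in_Lp_Lfun lg.
have p1E : (1 <= p%:E)%E by rewrite lee_fin ltW.
have := (Lfun_addr_closed mu p1E).2 _ _ lf lg.
move/(Lfun_integrable (ltW p1)).
by under eq_fun do rewrite /= ger0_norm ?addr_ge0 ?normc_ge0//.
Qed.

Lemma integrable_grad f g : in_Lp mu p f -> in_Lp mu p g ->
  mu.-integrable setT (fun x => (grad p (f x) (g x))%:E).
Proof.
move=> lf lg.
apply: (le_integrable measurableT _ _ (integrable_addnormc lf lg)).
  by apply/measurable_EFinP; apply: measurable_grad; [case: lf|case: lg].
move=> x _; rewrite lee_fin (ger0_norm (powR_ge0 _ _)).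
exact: normr_grad_le.
Qed.

End Lp.

(** * Characters and the topology of the dual group *)

Lemma cvg_normcB0 (R : realType) (I : Type) (F : set_system I) {FF : Filter F}
    (z : I -> R[i]) (l : R[i]) :
  (fun i => z i : R[i]^o) @ F --> (l : R[i]^o) ->
  normc (z i - l) @[i --> F] --> (0 : R).
Proof.
move/cvgrPdist_lt => h; apply/cvgrPdist_lt => e e0.
have := h e%:C%C; rewrite ltcR => /(_ e0); apply: filterS => i /=.
by rewrite normr_normc ltcR sub0r normrN ger0_norm ?normc_ge0// normcB.
Qed.

Section characters.
Context {R : realType} {G : zmodType}.
Local Notation Gamma := (dual_group R G).

(** The distance on a finite part of G is measured by a sum of squares because
    that sum is a trigonometric polynomial in g, see [real_trig_finite_dist]. *)
Definition finite_nbhs (g0 : Gamma) : set_system Gamma :=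
  [set U | exists (s : seq G) (d : R), 0 < d /\
    forall g : Gamma, \sum_(x <- s) normc (g x - g0 x) ^+ 2 < d -> U g].

Lemma sum_normc_ge0 (g g0 : Gamma) (s : seq G) :
  0 <= \sum_(x <- s) normc (g x - g0 x) ^+ 2.
Proof. by apply: sumr_ge0 => x _; rewrite sqr_ge0. Qed.

Lemma finite_nbhs_filter (g0 : Gamma) : Filter (finite_nbhs g0).
Proof.
split.
- by exists [::], 1; split.
- move=> U V [s [d [d0 Us]]] [t [e [e0 Vt]]].
  exists (s ++ t), (Num.min d e); split; first by rewrite lt_min d0.
  move=> g; rewrite big_cat/= => h; split.
    apply: Us; apply: (le_lt_trans _ (lt_le_trans h _)); rewrite ?ge_min ?lexx//.
    by rewrite lerDl sum_normc_ge0.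
  apply: Vt; apply: (le_lt_trans _ (lt_le_trans h _)); rewrite ?ge_min ?lexx ?orbT//.
  by rewrite lerDr sum_normc_ge0.
- move=> U V UV [s [d [d0 Us]]]; exists s, d; split=> // g /Us; exact: UV.
Qed.

Lemma cvg_dual (F : set_system Gamma) (g0 : Gamma) : Filter F ->
  (forall x : G, (fun g : Gamma => g x : R[i]^o) @ F --> (g0 x : R[i]^o)) ->
  F --> g0.
Proof.
move=> FF h.
have H : (@dual_fun R G : Gamma -> {ptws G -> R[i]^o}) @ F -->
    (dual_fun g0 : {ptws G -> R[i]^o}).
  apply/cvg_sup => x U [V] [[W] oW <-] Wg0 WU.
  by apply: (filterS WU); apply: (h x); exact: open_nbhs_nbhs.
move=> U; rewrite nbhsE => -[V [[W oW <-] Wg0] VU].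
by apply: (filterS VU); apply: H; exact: open_nbhs_nbhs.
Qed.

Lemma cvg_finite_nbhs (g0 : Gamma) : finite_nbhs g0 --> g0.
Proof.
have FF := finite_nbhs_filter g0.
apply: cvg_dual => x; apply/cvgrPdist_lt => e e0.
have eR : e = (Re e)%:C%C by rewrite RRe_real// gtr0_real.
have e0' : 0 < Re e by move: e0; rewrite eR ltcR.
exists [:: x], (Re e ^+ 2); split; first by rewrite exprn_gt0.
move=> g; rewrite big_seq1 /= normr_normc normcB eR ltcR => h.
by rewrite -ltr_sqr ?nnegrE ?normc_ge0 ?ltW.
Qed.

Lemma continuous_echar (x : G) : continuous (fun g : Gamma => g x : R[i]^o).
Proof.
move=> g0.
have c1 := @initial_continuous Gamma {ptws G -> R[i]^o} (@dual_fun R G) g0.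
have := @proj_continuous G (fun=> R[i]^o) x (dual_fun g0).
by move=> c2 U nU; exact: c1 (c2 U nU).
Qed.

Lemma continuous_normc_sub (x : G) (c : R[i]) :
  continuous (fun g : Gamma => normc (g x - c) : R).
Proof.
move=> g0; apply: (@cvg_normc R Gamma (nbhs g0) _ (fun g => g x - c) (g0 x - c)).
apply: (@cvg_normcB0 R Gamma (nbhs g0) _ (fun g => g x - c) (g0 x - c)).
apply: (@cvgB _ R[i]^o); last exact: cvg_cst.
exact: continuous_echar.
Qed.

Lemma continuous_Re_echar (x : G) : continuous (fun g : Gamma => Re (g x) : R).
Proof.
move=> g0; have := @continuous_normc_sub x (g0 x) g0.
rewrite /continuous_at subrr ComplexField.Normc.normc0.
exact: (@cvg_normcB_Re R Gamma (nbhs g0) _ (fun g => g x) (g0 x)).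
Qed.

Lemma continuous_Im_echar (x : G) : continuous (fun g : Gamma => Im (g x) : R).
Proof.
move=> g0; have := @continuous_normc_sub x (g0 x) g0.
rewrite /continuous_at subrr ComplexField.Normc.normc0.
exact: (@cvg_normcB_Im R Gamma (nbhs g0) _ (fun g => g x) (g0 x)).
Qed.

Lemma open_measurable_dual (U : set Gamma) : open U -> measurable U.
Proof. by move=> oU; exact: sub_sigma_algebra. Qed.

Lemma continuous_measurable_dual (f : Gamma -> R) : continuous f ->
  measurable_fun setT f.
Proof.
move=> cf; apply: (measurability _ (RGenOInfty.measurableE R)).
move=> _ [_ [a ->] <-]; rewrite setTI; apply: open_measurable_dual.
by apply: open_comp => //; rewrite set_itvE; exact: open_gt.
Qed.

Lemma cmeasurable_echar (x : G) : cmeasurable (echar x : Gamma -> R[i]).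
Proof.
split; apply: continuous_measurable_dual.
- exact: continuous_Re_echar.
- exact: continuous_Im_echar.
Qed.

Lemma normc_dual (g : Gamma) (x : G) : normc (g x) = 1.
Proof.
by have := dual_fun_norm g x; rewrite normr_normc => /(congr1 (@complex.Re R)).
Qed.

Lemma dual_fun0 (g : Gamma) : g 0 = 1.
Proof.
have g0 : g 0 != 0.
  apply/eqP => h; have := normc_dual g 0.
  by rewrite h ComplexField.Normc.normc0 => /eqP; rewrite eq_sym oner_eq0.
by apply: (mulfI g0); rewrite -dual_funD addr0 mulr1.
Qed.

Lemma dual_funN (g : Gamma) (x : G) : g (- x) = conjc (g x).
Proof.
have h : g x * g (- x) = 1 by rewrite -dual_funD subrr dual_fun0.
have g0 : g x != 0.
  by apply/eqP => e; move: h; rewrite e mul0r => /eqP; rewrite eq_sym oner_eq0.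
by apply: (mulfI g0); rewrite h -sqr_normc dual_fun_norm expr1n.
Qed.

End characters.

(** * The metric projection *)

Section trigonometric_polynomials.
Context {R : realType} {G : zmodType}.
Local Notation Gamma := (dual_group R G).
Implicit Types (S : set G) (tau : Gamma -> R[i]).

Lemma trig_polyD S tau1 tau2 : trig_poly S tau1 -> trig_poly S tau2 ->
  trig_poly S (fun g => tau1 g + tau2 g).
Proof.
move=> [s [Ss ->]] [t [St ->]]; exists (s ++ t); split.
  by move=> u; rewrite mem_cat => /orP[/Ss|/St].
by apply/funext => g; rewrite big_cat.
Qed.

Lemma trig_polyZ S tau (c : R[i]) : trig_poly S tau ->
  trig_poly S (fun g => c * tau g).
Proof.
move=> [s [Ss ->]]; exists [seq (c * u.1, u.2) | u <- s]; split.
  by move=> u /mapP[v vs ->]; exact: Ss vs.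
apply/funext => g; rewrite big_map mulr_sumr.
by apply: eq_bigr => u _; rewrite mulrA.
Qed.

Lemma trig_poly_echar S (a : R[i]) (x : G) : S x ->
  trig_poly S (fun g : Gamma => a * g x).
Proof.
move=> Sx; exists [:: (a, x)]; split.
  by move=> u; rewrite inE => /eqP ->.
by apply/funext => g; rewrite big_seq1.
Qed.

Lemma cmeasurable_trig_poly S tau : trig_poly S tau -> cmeasurable tau.
Proof.
move=> [s [_ ->]]; elim: s => [|u s IH].
  rewrite (_ : (fun g => _) = fun=> 0); first exact: cmeasurable_cst.
  by apply/funext => g; rewrite big_nil.
rewrite (_ : (fun g => _) =
  (fun g => u.1 * echar u.2 g + \sum_(v <- s) v.1 * echar v.2 g)).
  apply: cmeasurableD => //; apply: cmeasurableM; first exact: cmeasurable_cst.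
  exact: cmeasurable_echar.
by apply/funext => g; rewrite big_cons.
Qed.

End trigonometric_polynomials.

Section metric_projection.
Context {R : realType} {G : zmodType}.
Local Notation Gamma := (dual_group R G).
Variables (mu : {finite_measure set Gamma -> \bar R}) (p : R) (p1 : 1 < p).
Variable S : set G.
Implicit Types f g : Gamma -> R[i].

Let p0 : 0 < p. Proof. by rewrite (lt_trans ltr01). Qed.
Local Notation nrm f := (Lnorm mu p%:E (fun x => (normc (f x))%:E)).
Local Notation cl := (Lp_closure mu p (trig_poly S)).

Lemma in_Lp_trig_poly f : trig_poly S f -> in_Lp mu p f.
Proof.
move=> Sf; have mf := cmeasurable_trig_poly Sf.
move: Sf => [s [_ fE]].
apply: (@in_Lp_bounded _ _ mu p p1 (\sum_(u <- s) normc u.1)) => //.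
move=> x; rewrite fE; elim: s {fE} => [|u s IH].
  by rewrite !big_nil ComplexField.Normc.normc0.
rewrite !big_cons (le_trans (normcD_le _ _))// lerD//.
by rewrite ComplexField.Normc.normcM /echar normc_dual mulr1.
Qed.

Lemma Lp_closure_trig_poly f : trig_poly S f -> cl f.
Proof.
move=> Sf; split; first exact: in_Lp_trig_poly.
move=> e e0; exists f => //.
rewrite (_ : (fun x => _) = cst 0%E).
  by rewrite Lnorm0 ?lte_fin// eqe gt_eqF.
by apply/funext => x; rewrite subrr ComplexField.Normc.normc0.
Qed.

Lemma Lp_closureD f g : cl f -> cl g -> cl (fun x => f x + g x).
Proof.
move=> [lf cf] [lg cg]; split; first exact: in_LpD.
move=> e e0; have e20 : 0 < e / 2 by rewrite divr_gt0.
have [t St ft] := cf _ e20; have [u Su gu] := cg _ e20.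
exists (fun x => t x + u x); first exact: trig_polyD.
rewrite (_ : (fun x => _) =
  (fun x => (normc ((f x - t x) + (g x - u x)))%:E)); last first.
  by apply/funext => x; rewrite opprD addrACA.
have mt := cmeasurable_trig_poly St; have mu1 := cmeasurable_trig_poly Su.
apply: (le_lt_trans (Lnorm_normcD _ p1 _ _)).
- by apply: cmeasurableB => //; case: lf.
- by apply: cmeasurableB => //; case: lg.
by rewrite (splitr e) EFinD lteD.
Qed.

Lemma Lp_closureZ f (c : R[i]) : cl f -> cl (fun x => c * f x).
Proof.
move=> [lf cf]; split; first exact: in_LpZ.
move=> e e0; have M0 : 0 < normc c + 1 by rewrite ltr_wpDl// normc_ge0.
have [t St ft] := cf _ (divr_gt0 e0 M0).
exists (fun x => c * t x); first exact: trig_polyZ.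
rewrite (_ : (fun x => _) = (fun x => (normc (c * (f x - t x)))%:E)); last first.
  by apply/funext => x; rewrite mulrBr.
rewrite Lnorm_normcZ//; last first.
  by apply: cmeasurableB; [case: lf|exact: cmeasurable_trig_poly St].
apply: (@le_lt_trans _ _ ((normc c + 1)%:E * nrm (fun x => f x - t x))%E).
  by apply: lee_wpmul2r; rewrite ?Lnorm_ge0// lee_fin lerDl.
by rewrite -lte_pdivlMl// -EFinM mulrC.
Qed.

(** By Minkowski's inequality, approximants of f in the subspace are nearly as
    close to 1 as f is. *)
Lemma dist_p_le f : cl f ->
  (dist_p mu p S <= pth_integral mu p (fun x => (1 - f x)%R))%E.
Proof.
move=> [lf cf]; rewrite (pth_integralE mu p1).
have l1f : in_Lp mu p (fun x => 1 - f x) by apply: in_LpB => //; exact: in_Lp_cst.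
have [m1f fin] := l1f; rewrite /finite_norm in fin.
have ge0 := Lnorm_ge0 mu p%:E (fun x => (normc (1 - f x))%:E).
pose N := fine (nrm (fun x => 1 - f x)).
have NE : nrm (fun x => 1 - f x) = N%:E by rewrite fineK// ge0_fin_numE.
have N0 : 0 <= N by rewrite fine_ge0.
rewrite NE poweR_EFin.
have step n : (dist_p mu p S <= ((N + n.+1%:R^-1) `^ p)%:E)%E.
  have e0 : 0 < n.+1%:R^-1 :> R by rewrite invr_gt0.
  have [t St ft] := cf _ e0.
  apply: (@le_trans _ _ (pth_integral mu p (fun x => 1 - t x))).
    by apply: ereal_inf_lbound; exists t.
  rewrite (pth_integralE mu p1) -poweR_EFin.
  have ? : (0 <= N%:E + n.+1%:R^-1%:E)%E by rewrite lee_fin addr_ge0// ltW.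
  apply: gt0_ler_poweR; rewrite ?(ltW p0)// ?in_itv/= ?leey ?andbT ?Lnorm_ge0//.
  rewrite (_ : (fun x => _) = (fun x => (normc ((1 - f x) + (f x - t x)))%:E)).
    apply: (le_trans (Lnorm_normcD _ p1 _ _)) => //.
      by apply: cmeasurableB; [case: lf|exact: cmeasurable_trig_poly St].
    by rewrite NE EFinD leeD// ltW.
  by apply/funext => x; rewrite subrKA.
have cv : (N + n.+1%:R^-1) `^ p @[n --> \oo] --> N `^ p.
  apply: cvg_powR => //; last by right.
    by move=> n; rewrite addr_ge0// invr_ge0.
  by rewrite -[X in _ --> X]addr0; apply: cvgD; [exact: cvg_cst|exact: cvg_harmonic].
have cvE : ((N + n.+1%:R^-1) `^ p)%:E @[n --> \oo] --> (N `^ p)%:E.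
  by apply: cvg_EFin => //; exact: nearW.
rewrite -(cvg_lim _ cvE)//; apply: lime_ge; first by apply/cvg_ex; eexists; exact: cvE.
exact: nearW.
Qed.

(** Moving phi by t g with t > 0 cannot bring it closer to 1. By convexity, the
    loss is at most t times the derivative at the moved point; so the integral
    of the latter is nonpositive, and t can go to 0 by dominated convergence. *)
Lemma integral_grad_le0 phi g : metric_projection mu p S phi -> cl g ->
  (\int[mu]_x (grad p (1 - phi x)%R (g x))%:E <= 0)%E.
Proof.
move=> [clphi minphi] clg; have [lphi _] := clphi; have [lg _] := clg.
pose z x := 1 - phi x.
have lz : in_Lp mu p z by apply: in_LpB => //; exact: in_Lp_cst.
pose t n : R[i] := (n.+1%:R^-1)%:C%C.
pose zn n x := z x - t n * g x.
have lzn n : in_Lp mu p (zn n) by apply: in_LpB => //; exact: in_LpZ.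
have step n : (\int[mu]_x (grad p (zn n x) (g x))%:E <= 0)%E.
  have t0 : 0 < n.+1%:R^-1 :> R by rewrite invr_gt0.
  have iz := integrable_pth p1 lz; have izn := integrable_pth p1 (lzn n).
  have ig := integrable_grad p1 (lzn n) lg.
  have : ((p * n.+1%:R^-1)%:E * \int[mu]_x (grad p (zn n x) (g x))%:E <= 0)%E.
    rewrite -integralZl//.
    apply: (@le_trans _ _ (\int[mu]_x
      ((normc (z x) `^ p)%:E - (normc (zn n x) `^ p)%:E))%E).
      apply: le_integral => //; first exact: integrableZl.
        exact: integrableB.
      move=> x _; rewrite -EFinM -EFinB lee_fin.
      rewrite lerBrDl -mulrA -gradZ (_ : _ * g x = z x - zn n x).
        exact: normc_powR_convex.
      by rewrite /zn subKr.
    rewrite integralB//.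
    have fz : (\int[mu]_x (normc (z x) `^ p)%:E)%E \is a fin_num
      by exact: integrable_fin_num.
    have fzn : (\int[mu]_x (normc (zn n x) `^ p)%:E)%E \is a fin_num
      by exact: integrable_fin_num.
    rewrite sube_le0//.
    have := minphi; rewrite /pth_integral -/(z _) => ->.
    rewrite (_ : (\int[mu]_x _)%E =
      pth_integral mu p (fun x => 1 - (phi x + t n * g x))); last first.
      by apply: eq_integral => x _; rewrite /zn /z opprD addrA.
    apply: dist_p_le; apply: Lp_closureD => //; exact: Lp_closureZ.
  by rewrite pmule_rle0// lte_fin mulr_gt0.
have cvz x : normc (zn n x - z x) @[n --> \oo] --> (0 : R).
  rewrite (_ : (fun n => _) = (fun n => n.+1%:R^-1 * normc (g x))).
    by rewrite -(mul0r (normc (g x))); apply: cvgM; [exact: cvg_harmonic|exact: cvg_cst].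
  apply/funext => n; rewrite /zn addrAC subrr sub0r normcN.
  by rewrite ComplexField.Normc.normcM normc_real ger0_norm.
have dom n x : (`|(grad p (zn n x) (g x))%:E| <=
    ((normc (z x) + (normc (g x) + normc (g x))) `^ p)%:E)%E.
  rewrite lee_fin (le_trans (normr_grad_le p1 _ _))//.
  apply: ge0_ler_powR; rewrite ?nnegrE ?(ltW p0) ?addr_ge0 ?normc_ge0//.
  rewrite addrA lerD2r (le_trans (normcB_le _ _))// lerD2l.
  rewrite ComplexField.Normc.normcM normc_real ger0_norm// ler_piMl ?normc_ge0//.
  by rewrite invf_le1// ler1n.
have idom : mu.-integrable setT
    (fun x => ((normc (z x) + (normc (g x) + normc (g x))) `^ p)%:E).
  have := integrable_addnormc p1 lz (in_LpZ p1 (2 : R)%:C%C lg).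
  apply: eq_integrable => // x _; congr (_ `^ _)%:E; congr (_ + _).
  by rewrite ComplexField.Normc.normcM normc_real ger0_norm// mulr_natl mulr2n.
have cvg x : (grad p (zn n x) (g x))%:E @[n --> \oo] --> (grad p (z x) (g x))%:E.
  by apply: cvg_EFin; [exact: nearW|exact: cvg_grad].
have [_ _ cv] := @dominated_convergence _ _ _ mu setT measurableT
  (fun n x => (grad p (zn n x) (g x))%:E) (fun x => (grad p (z x) (g x))%:E) _
  (fun n => measurable_int _ (integrable_grad p1 (lzn n) lg))
  (measurable_int _ (integrable_grad p1 lz lg))
  (aeW _ (fun x _ => cvg x)) idom
  (aeW _ (fun x n _ => dom n x)).
rewrite -(cvg_lim _ cv)//.
by apply: lime_le; [apply/cvg_ex; eexists; exact: cv|exact: nearW].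
Qed.

Lemma integral_grad_eq0 phi g : metric_projection mu p S phi -> cl g ->
  (\int[mu]_x (grad p (1 - phi x)%R (g x))%:E = 0)%E.
Proof.
move=> mphi clg; have [[lphi _] _] := mphi; have [lg _] := clg.
have l1 : in_Lp mu p (fun x => 1 - phi x) by apply: in_LpB => //; exact: in_Lp_cst.
have le0 := integral_grad_le0 mphi clg.
have := integral_grad_le0 mphi (Lp_closureZ (-1) clg).
under eq_integral do rewrite mulN1r gradN EFinN.
rewrite integralN/=; last first.
  exact: integrable_add_def (integrable_grad p1 l1 lg).
by rewrite leeNl oppe0 => ge0; apply/eqP; rewrite eq_le le0 ge0.
Qed.

(** As [grad p z z] is the p-th power of the modulus of z, the derivative at
    the minimiser in the direction of the constant 1 is the minimum itself. *)
Lemma integral_grad1 phi : metric_projection mu p S phi ->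
  (\int[mu]_x (grad p (1 - phi x)%R 1%R)%:E = dist_p mu p S)%E.
Proof.
move=> mphi; have [clphi minphi] := mphi; have [lphi _] := clphi.
have l1 : in_Lp mu p (fun x => 1 - phi x) by apply: in_LpB => //; exact: in_Lp_cst.
rewrite -minphi /pth_integral.
transitivity (\int[mu]_x ((grad p (1 - phi x)%R (1 - phi x)%R)%:E +
    (grad p (1 - phi x)%R (phi x))%:E)%E)%E.
  by apply: eq_integral => x _; rewrite -EFinD -gradD subrK.
rewrite integralD//; [|exact: integrable_grad..].
rewrite (integral_grad_eq0 mphi clphi) adde0.
by apply: eq_integral => x _; rewrite gradzz.
Qed.

End metric_projection.

(** * Separating sets by real trigonometric polynomials *)

Section real_trigonometric.
Context {R : realType} {G : zmodType}.
Local Notation Gamma := (dual_group R G).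
Implicit Types (F : Gamma -> R) (g : Gamma).

(** Real parts of trigonometric polynomials on all of G. The inductive form
    reduces linear identities between integrals to single characters. *)
Inductive real_trig : (Gamma -> R) -> Prop :=
| real_trig_char a x : real_trig (fun g => Re (a * g x))
| real_trigD F1 F2 : real_trig F1 -> real_trig F2 ->
    real_trig (fun g => F1 g + F2 g).

Lemma eq_real_trig F1 F2 : F1 =1 F2 -> real_trig F1 -> real_trig F2.
Proof. by move=> /funext ->. Qed.

Lemma real_trig_cst (c : R) : real_trig (fun=> c).
Proof.
apply: eq_real_trig (real_trig_char c%:C%C 0) => g.
by rewrite dual_fun0 mulr1.
Qed.

Lemma real_trigZ (c : R) F : real_trig F -> real_trig (fun g => c * F g).
Proof.
elim=> [a x|F1 F2 _ IH1 _ IH2].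
  apply: eq_real_trig (real_trig_char (c%:C%C * a) x) => g.
  by rewrite -mulrA; case: (a * g x) => u v /=; rewrite mul0r subr0.
by apply: eq_real_trig (real_trigD IH1 IH2) => g; rewrite mulrDr.
Qed.

(** The product formula 2 Re u Re v = Re (u v) + Re (u v'), where v' is the
    conjugate of v; the conjugate of the character e_y is e_(- y). *)
Lemma real_trigM F1 F2 : real_trig F1 -> real_trig F2 ->
  real_trig (fun g => F1 g * F2 g).
Proof.
move=> h1 h2; elim: h1 => [a x|F3 F4 _ IH3 _ IH4]; last first.
  by apply: eq_real_trig (real_trigD IH3 IH4) => g; rewrite mulrDl.
elim: h2 => [b y|F3 F4 _ IH3 _ IH4]; last first.
  by apply: eq_real_trig (real_trigD IH3 IH4) => g; rewrite mulrDr.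
have := real_trigZ 2^-1 (real_trigD (real_trig_char (a * b) (x + y))
  (real_trig_char (a * conjc b) (x - y))).
apply: eq_real_trig => g; rewrite !dual_funD dual_funN.
by case: a b (g x) (g y) => [a a'] [b b'] [c c'] [d d'] /=; field.
Qed.

Lemma real_trigB F1 F2 : real_trig F1 -> real_trig F2 ->
  real_trig (fun g => F1 g - F2 g).
Proof.
move=> h1 h2; apply: eq_real_trig (real_trigD h1 (real_trigZ (-1) h2)) => g.
by rewrite mulN1r.
Qed.

Lemma real_trigX F n : real_trig F -> real_trig (fun g => F g ^+ n).
Proof.
move=> h; elim: n => [|n IH].
  by apply: eq_real_trig (real_trig_cst 1) => g; rewrite expr0.
by apply: eq_real_trig (real_trigM h IH) => g; rewrite exprS.
Qed.

Lemma continuous_real_trig F : real_trig F -> continuous F.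
Proof.
elim=> [a x|F1 F2 _ IH1 _ IH2].
  have -> : (fun g => Re (a * g x)) =
      (fun g : Gamma => Re a * Re (g x) - Im a * Im (g x)).
    by apply/funext => g; case: a (g x) => u v [].
  move=> g0; apply: (@continuousB R R^o Gamma (fun g => Re a * Re (g x))
    (fun g => Im a * Im (g x))).
    by apply: continuousM; [exact: cst_continuous|exact: continuous_Re_echar].
  by apply: continuousM; [exact: cst_continuous|exact: continuous_Im_echar].
by move=> g0; apply: (@continuousD R R^o Gamma F1 F2); [exact: IH1|exact: IH2].
Qed.

Lemma real_trig_bounded F : real_trig F -> exists M, forall g, `|F g| <= M.
Proof.
elim=> [a x|F1 F2 _ [M1 h1] _ [M2 h2]].
  exists (normc a) => g; rewrite (le_trans (normr_Re_le _))//.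
  by rewrite ComplexField.Normc.normcM normc_dual mulr1.
by exists (M1 + M2) => g; rewrite (le_trans (ler_normD _ _))// lerD.
Qed.

Lemma real_trig_finite_dist (g0 : Gamma) (s : seq G) :
  real_trig (fun g => \sum_(x <- s) normc (g x - g0 x) ^+ 2).
Proof.
elim: s => [|x s IH].
  by apply: eq_real_trig (real_trig_cst 0) => g; rewrite big_nil.
have h : real_trig (fun g => normc (g x - g0 x) ^+ 2).
  (* On the unit circle the square of |z - c| is 2 - 2 Re (z c^-1). *)
  have := real_trigD (real_trig_cst 2) (real_trig_char (- 2%:C%C * conjc (g0 x)) x).
  apply: eq_real_trig => g; rewrite sqr_normc_ReIm.
  have := sqr_normc_ReIm (g x); have := sqr_normc_ReIm (g0 x).
  rewrite !normc_dual !expr1n.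
  case: (g x) (g0 x) => [a b] [c d] /= h1 h2.
  rewrite (_ : _ ^+ 2 + _ = (a ^+ 2 + b ^+ 2) + (c ^+ 2 + d ^+ 2) -
    2 * (a * c + b * d)); last by ring.
  by rewrite -h1 -h2; ring.
by apply: eq_real_trig (real_trigD h IH) => g; rewrite big_cons.
Qed.

Lemma bernoulli_ge (a : R) (m : nat) : 0 <= a <= 1 -> 1 - m%:R * a <= (1 - a) ^+ m.
Proof.
move=> /andP[a0 a1]; elim: m => [|m IH]; first by rewrite mul0r subr0 expr0.
rewrite exprS; apply: (@le_trans _ _ ((1 - a) * (1 - m%:R * a))); last first.
  by apply: ler_wpM2l => //; rewrite subr_ge0.
rewrite -natr1; have : 0 <= m%:R * a * a by rewrite !mulr_ge0.
set c := m%:R; nra.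
Qed.

Lemma bernoulli_le (a : R) (m : nat) : 0 <= a <= 1 ->
  (1 - a) ^+ m * (m%:R * a) <= 1.
Proof.
move=> /andP[a0 a1]; have h1 : 1 + m%:R * a <= (1 + a) ^+ m.
  elim: m => [|m IH]; first by rewrite mul0r addr0 expr0.
  rewrite exprS; apply: (@le_trans _ _ ((1 + a) * (1 + m%:R * a))); last first.
    by apply: ler_wpM2l => //; rewrite addr_ge0.
  rewrite -natr1; have : 0 <= m%:R * a * a by rewrite !mulr_ge0.
  set c := m%:R; nra.
have p0 : 0 <= (1 - a) ^+ m by rewrite exprn_ge0// subr_ge0.
apply: (@le_trans _ _ ((1 - a) ^+ m * (1 + a) ^+ m)).
  by apply: ler_wpM2l => //; rewrite (le_trans _ h1)// lerDr.
rewrite -exprMn; apply: exprn_ile1.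
  by rewrite mulr_ge0 ?subr_ge0 ?addr_ge0.
nra.
Qed.

(** On the unit interval, the polynomials [(1 - u ^+ n) ^+ (k ^ n)] tend to 1
    below [1 / k] and to 0 above it, uniformly away from [1 / k]. Bernoulli's
    inequality quantifies this by powers of [k%:R * u]. *)
Lemma threshold_ge (u : R) (k n : nat) : 0 <= u <= 1 -> k%:R * u <= 2^-1 ->
  1 - 2^-1 ^+ n <= (1 - u ^+ n) ^+ (k ^ n).
Proof.
move=> /andP[u0 u1] ku; apply: le_trans (@bernoulli_ge (u ^+ n) (k ^ n) _).
  by rewrite lerD2l lerN2 natrX -exprMn; apply: lerXn2r;
    rewrite ?nnegrE ?mulr_ge0 ?invr_ge0.
by rewrite exprn_ge0// exprn_ile1.
Qed.

Lemma threshold_le (u : R) (k n : nat) : 0 <= u <= 1 -> 2 <= k%:R * u ->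
  (1 - u ^+ n) ^+ (k ^ n) <= 2^-1 ^+ n.
Proof.
move=> /andP[u0 u1] ku.
have un : 0 <= u ^+ n <= 1 by rewrite exprn_ge0// exprn_ile1.
have p0 : 0 <= (1 - u ^+ n) ^+ (k ^ n).
  by rewrite exprn_ge0// subr_ge0; case/andP: un.
have := @bernoulli_le (u ^+ n) (k ^ n) un.
rewrite natrX -exprMn => h.
rewrite exprVn -[leRHS]mul1r ler_pdivlMr ?exprn_gt0//.
apply: le_trans h; apply: ler_wpM2l => //.
by apply: lerXn2r; rewrite ?nnegrE ?mulr_ge0.
Qed.

Lemma exp_half_small (e : R) : 0 < e -> exists n, (2^-1 : R) ^+ n <= e.
Proof.
move=> e0.
have c : (2^-1 : R) ^+ n @[n --> \oo] --> (0 : R).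
  by apply: cvg_expr; rewrite gtr0_norm// invf_lt1// ltr1n.
have /cvgrPdist_le/(_ _ e0)[n _ /(_ n (leqnn n))] := c.
by rewrite sub0r normrN ger0_norm ?exprn_ge0//; exists n.
Qed.

Definition separating (A U : set Gamma) (e : R) F :=
  [/\ forall g, 0 <= F g <= 1, forall g, A g -> 1 - e <= F g &
      forall g, ~ U g -> F g <= e].

Definition separated (A U : set Gamma) :=
  forall e : R, 0 < e -> exists2 F, real_trig F & separating A U e F.

Lemma separatedS A B U : A `<=` B -> separated B U -> separated A U.
Proof.
move=> AB sB e e0; have [F tF [F1 F2 F3]] := sB e e0.
by exists F => //; split=> // g /AB; exact: F2.
Qed.

Lemma separated_setU A B U : separated A U -> separated B U ->
  separated (A `|` B) U.
Proof.
move=> sA sB e e0; have e20 : 0 < e / 2 by rewrite divr_gt0.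
have [F tF [F1 F2 F3]] := sA _ e20; have [H tH [H1 H2 H3]] := sB _ e20.
exists (fun g => 1 - (1 - F g) * (1 - H g)).
  apply: real_trigB; first exact: real_trig_cst.
  by apply: real_trigM; apply: real_trigB => //; exact: real_trig_cst.
split=> g.
- have := F1 g; have := H1 g; move=> /andP[? ?] /andP[? ?]; apply/andP; split; nra.
- have := F1 g; have := H1 g; move=> /andP[? ?] /andP[? ?] [/F2|/H2] ?; nra.
- have := F1 g; have := H1 g.
  by move=> /andP[? ?] /andP[? ?] nU; have := F3 g nU; have := H3 g nU => ? ?; nra.
Qed.

Lemma separated_set0 U : separated set0 U.
Proof.
move=> e e0; exists (fun=> 0); first exact: real_trig_cst.
by split=> // g; [rewrite lexx ler01|move=> _; exact: ltW].
Qed.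

(** The threshold polynomials are applied to a multiple u of the squared
    distance f to g0 on a finite part of G. *)
Lemma separated_nbhs (U : set Gamma) g0 : open U -> U g0 ->
  exists2 V, nbhs g0 V & separated V U.
Proof.
move=> oU Ug0.
have [s [d [d0 sU]]] : finite_nbhs g0 U.
  by apply: cvg_finite_nbhs; exact: open_nbhs_nbhs.
pose f g := \sum_(x <- s) normc (g x - g0 x) ^+ 2.
have tf : real_trig f := real_trig_finite_dist g0 s.
have f0 g : 0 <= f g := sum_normc_ge0 g g0 s.
have [M fM] := real_trig_bounded tf.
exists [set g | f g < d / 4].
  have := continuous_real_trig tf; move=> /(_ g0)/cvgrPdist_lt/(_ (d / 4)).
  rewrite divr_gt0// => /(_ isT).
  have fg0 : f g0 = 0.
    by rewrite /f big1// => x _; rewrite subrr ComplexField.Normc.normc0 expr0n.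
  apply: filterS => g /=; rewrite fg0 sub0r normrN ger0_norm//.
(* The scaling is such that f < d / 4 means k u < 1 / 2 and f >= d means
   k u >= 2; with k this large, u is at most 1. *)
pose k := (Num.truncn (2 * M / d)).+1.
have d20 : 0 < d / 2 by rewrite divr_gt0.
have k0 : 0 < k%:R :> R by rewrite ltr0n.
have Mk : M <= k%:R * (d / 2).
  have : 2 * M / d < k%:R by rewrite /k truncnS_gt.
  rewrite ltr_pdivrMr// => ?; lra.
have c0 : 0 < k%:R * (d / 2) by rewrite mulr_gt0.
pose u g := (k%:R * (d / 2))^-1 * f g.
have tu : real_trig u by exact: real_trigZ.
have u01 g : 0 <= u g <= 1.
  rewrite /u mulr_ge0 ?invr_ge0 ?(ltW c0)//= mulrC ler_pdivrMr// mul1r.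
  by rewrite (le_trans _ Mk)// (le_trans (ler_norm _)).
have ku g : k%:R * u g = f g / (d / 2).
  by rewrite /u; field; rewrite !gt_eqF.
move=> e e0; have [n ne] := exp_half_small e0.
exists (fun g => (1 - u g ^+ n) ^+ (k ^ n)).
  by apply: real_trigX; apply: real_trigB; [exact: real_trig_cst|exact: real_trigX].
split=> g.
- have /andP[u0 u1] := u01 g.
  by rewrite exprn_ge0 ?exprn_ile1// ?subr_ge0 ?exprn_ile1// gerBl exprn_ge0.
- move=> /= fg; apply: (@le_trans _ _ (1 - 2^-1 ^+ n)); first by rewrite lerD2l lerN2.
  by apply: threshold_ge => //; rewrite ku ler_pdivrMr//; lra.
- move=> nUg; apply: le_trans ne; apply: threshold_le => //.
  rewrite ku ler_pdivlMr//; have : ~ f g < d by move=> /sU.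
  by move/negP; rewrite -leNgt => ?; lra.
Qed.

(** This does the work of Urysohn's lemma and of the Stone-Weierstrass theorem
    together. If K were not separated, the sets that cover K up to a separated
    set would form a proper filter; but its cluster point in K has a separated
    neighbourhood. *)
Lemma separated_compact (K U : set Gamma) : compact K -> open U -> K `<=` U ->
  separated K U.
Proof.
move=> cK oU KU; apply: contrapT => nsK.
pose H := [set A : set Gamma | separated (K `\` A) U].
have HF : ProperFilter H.
  split=> [|].
    by rewrite /H /= setD0.
  split.
  - by rewrite /H /= setDT; exact: separated_set0.
  - move=> A B hA hB; rewrite /H /= setDIr; exact: separated_setU.
  - move=> A B AB; apply: separatedS => g [Kg nB]; split=> // /AB //.
have HK : H K by rewrite /H /= setDv; exact: separated_set0.
have [g [Kg clg]] := cK _ HF HK.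
have [V Vg sV] := separated_nbhs oU (KU _ Kg).
have HV : H (~` V).
  by apply: separatedS sV => h [_] /=; exact: contrapT.
by have [h [nVh Vh]] := clg _ _ HV Vg.
Qed.

End real_trigonometric.

(** * Uniqueness of Fourier coefficients *)

Section dual_group_facts.
Context {R : realType} {G : zmodType}.
Local Notation Gamma := (dual_group R G).

Lemma dual_group_ext (a b : Gamma) : (forall x, a x = b x) -> a = b.
Proof.
case: a b => [f fD f1] [h hD h1] /= /funext e; case: h / e in hD h1 *.
by congr DualGroup; exact: Prop_irrelevance.
Qed.

Lemma dual_group_hausdorff : hausdorff_space Gamma.
Proof.
move=> a b cab; apply: dual_group_ext => x; apply: contrapT => abx.
pose d := normc (a x - b x).
have d0 : 0 < d.
  rewrite lt_neqAle normc_ge0 andbT eq_sym; apply/eqP.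
  by move=> /ComplexField.Normc.eq0_normc/eqP; rewrite subr_eq0 => /eqP.
have d20 : 0 < d / 2 by rewrite divr_gt0.
have nb (c : Gamma) : nbhs c [set g : Gamma | normc (g x - c x) < d / 2].
  have /cvgrPdist_lt/(_ _ d20) := @continuous_normc_sub R G x (c x) c.
  apply: filterS => g /=; rewrite subrr ComplexField.Normc.normc0 sub0r normrN.
  by rewrite ger0_norm ?normc_ge0.
have [g [/= ga gb]] := cab _ _ (nb a) (nb b).
have : d <= normc (g x - a x) + normc (g x - b x).
  rewrite /d (normcB (g x)) (le_trans _ (normcD_le _ _))//.
  by rewrite subrKA.
by apply/negP; rewrite -ltNge (splitr d) ltrD.
Qed.

Lemma measurable_compact_dual (K : set Gamma) : compact K -> measurable K.
Proof.
move=> /(compact_closed dual_group_hausdorff) cK.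
rewrite -[K]setCK; apply: measurableC; apply: open_measurable_dual.
exact: closed_openC.
Qed.

Lemma measurable_real_trig (F : Gamma -> R) : real_trig F -> measurable_fun setT F.
Proof. by move=> tF; apply: continuous_measurable_dual; exact: continuous_real_trig. Qed.

End dual_group_facts.

Section uniqueness.
Context {R : realType} {G : zmodType}.
Local Notation Gamma := (dual_group R G).
Implicit Types (mu : {finite_measure set Gamma -> \bar R}) (f F : Gamma -> R).

Lemma integrable_real_trigM mu f F : mu.-integrable setT (EFin \o f) ->
  real_trig F -> mu.-integrable setT (EFin \o (fun g => F g * f g)).
Proof.
move=> fi tF; have [M FM] := real_trig_bounded tF.
apply: (le_integrable measurableT (g := fun g => (M%:E * (f g)%:E)%E)).
- apply/measurable_EFinP; apply: measurable_funM; first exact: measurable_real_trig.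
  by apply/measurable_EFinP; exact: (measurable_int mu).
- move=> g _ /=; rewrite lee_fin !normrM ler_wpM2r//.
  by rewrite (le_trans (FM g))// ler_norm.
- exact: integrableZl.
Qed.

Lemma separatingS (A B U V : set Gamma) (e : R) F : A `<=` B -> V `<=` U ->
  separating B V e F -> separating A U e F.
Proof.
move=> AB VU [F1 F2 F3].
by split=> // g; [move/AB/F2|move=> nU; apply: F3 => /VU].
Qed.

(** Regularity encloses A between a compact and an open set with a small
    difference; a separating F then approximates the indicator of A outside of
    that difference. *)
Lemma separating_approx mu f (A : set Gamma) (e : R) : regular_measure mu ->
  mu.-integrable setT (EFin \o f) -> measurable A -> 0 < e ->
  exists K U, [/\ compact K, open U, K `<=` A, A `<=` U &
    forall (d : R) F, 0 < d -> real_trig F -> separating K U d F ->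
    `|(\int[mu]_g (F g * f g))%R - (\int[mu]_(g in A) f g)%R| <=
       e + d * (\int[mu]_g `|f g|)%R].
Proof.
move=> reg fi mA e0.
have [r [r0 hr]] := integral_normr_continuous fi e0.
have r20 : 0 < r / 2 by rewrite divr_gt0.
have [supA infA] := reg A mA.
have finA : (mu : {measure set Gamma -> \bar R}) A \is a fin_num by exact: fin_num_measure.
have [_ [K [cK KA] <-] hK] := @ub_ereal_sup_adherent R _ _ r20
  (eq_ind _ (fun x => x \is a fin_num) finA _ supA).
have [_ [U [oU AU] <-] hU] := @lb_ereal_inf_adherent R _ _ r20
  (eq_ind _ (fun x => x \is a fin_num) finA _ infA).
rewrite -supA in hK; rewrite -infA in hU.
exists K, U; split => // d F d0 tF [F1 F2 F3].
have mK := measurable_compact_dual cK; have mU := open_measurable_dual oU.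
have mUK : measurable (U `\` K) by exact: measurableD.
have smallUK : (mu (U `\` K) < r%:E)%E.
  have finU : (mu : {measure set Gamma -> \bar R}) U \is a fin_num by exact: fin_num_measure.
  have finK : (mu : {measure set Gamma -> \bar R}) K \is a fin_num by exact: fin_num_measure.
  have -> : (mu (U `\` K) = (mu : {measure set Gamma -> \bar R}) U -
      (mu : {measure set Gamma -> \bar R}) K)%E.
    rewrite measureD//; last by rewrite ltey_eq finU.
    by rewrite setIidr//; exact: subset_trans AU.
  move: hK hU; rewrite -(fineK finA) -(fineK finU) -(fineK finK).
  rewrite -!EFinB -EFinD !lte_fin; lra.
have fA : mu.-integrable setT (EFin \o (f \_ A)).
  rewrite -restrict_EFin; apply: (integrable_mkcond _ mA).1.
  exact: (integrableS measurableT mA (@subsetT _ _) fi).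
have fUK : mu.-integrable setT (EFin \o ((Num.norm \o f) \_ (U `\` K))).
  rewrite -restrict_EFin; apply: (integrable_mkcond _ mUK).1.
  exact: (integrableS measurableT mUK (@subsetT _ _) (integrable_norm fi)).
have fn : mu.-integrable setT (EFin \o (fun g => `|f g|)) by exact: integrable_norm.
have dfn : mu.-integrable setT (EFin \o (fun g => d * `|f g|)).
  by rewrite (_ : _ \o _ = (fun g => (d%:E * (`|f g|)%:E)%E))//; exact: integrableZl.
have Ff := integrable_real_trigM fi tF.
rewrite (Rintegral_mkcond _ A) -RintegralB//.
have FfA : mu.-integrable setT (EFin \o (fun g => F g * f g - (f \_ A) g)).
  by rewrite (_ : _ \o _ = (fun g => ((F g * f g)%:E - ((f \_ A) g)%:E)%E))//;
    exact: integrableB.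
apply: (le_trans (le_normr_Rintegral measurableT FfA)).
apply: (@le_trans _ _ (\int[mu]_g (((Num.norm \o f) \_ (U `\` K)) g + d * `|f g|))).
  apply: le_Rintegral => //.
  - exact: integrable_norm.
  - by rewrite (_ : _ \o _ =
      (fun g => (((Num.norm \o f) \_ (U `\` K)) g)%:E + (d * `|f g|)%:E)%E)//;
      exact: integrableD.
  move=> g _; rewrite /patch.
  have /andP[F0 F1'] := F1 g; have n0 := normr_ge0 (f g).
  have dn0 : 0 <= d * `|f g| by rewrite mulr_ge0// ltW.
  have [gK|gK] := pselect (K g).
    have gA : g \in A by rewrite inE; exact: KA.
    rewrite gA memNset/=; last by case.
    rewrite add0r -{2}[f g]mul1r -mulrBl normrM ler_wpM2r//.
    by rewrite ler0_norm ?subr_le0// opprB; have := F2 g gK; lra.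
  have [gU|gU] := pselect (U g).
    rewrite (mem_set (conj gU gK : (U `\` K) g))/=.
    suff : `|F g * f g - (if g \in A then f g else point)| <= `|f g| by lra.
    case: ifP => _.
      rewrite -{2}[f g]mul1r -mulrBl normrM ler_piMl// ler0_norm ?subr_le0//.
      by rewrite opprB; lra.
    by rewrite subr0 normrM ger0_norm// ler_piMl.
  have gA : g \notin A by apply/negP; rewrite inE => /AU.
  rewrite (negbTE gA) memNset/=; last by case.
  by rewrite subr0 add0r normrM ger0_norm// ler_wpM2r// F3.
rewrite RintegralD// RintegralZl// lerD2r.
by rewrite -Rintegral_mkcond ltW//; exact: hr.
Qed.

(** A single real trigonometric polynomial F approximates the indicator of A for
    both measures at once, provided that it separates the union of the two
    compact sets from the intersection of the two open sets. *)
Lemma fourier_uniqueness mu1 mu2 f1 f2 :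
  regular_measure mu1 -> regular_measure mu2 ->
  mu1.-integrable setT (EFin \o f1) -> mu2.-integrable setT (EFin \o f2) ->
  (forall F, real_trig F ->
    (\int[mu1]_g (F g * f1 g))%R = (\int[mu2]_g (F g * f2 g))%R) ->
  forall A, measurable A ->
    (\int[mu1]_(g in A) f1 g)%R = (\int[mu2]_(g in A) f2 g)%R.
Proof.
move=> r1 r2 i1 i2 eqF A mA; apply/eqP; rewrite -subr_eq0 -normr_le0.
apply/ler_addgt0Pl => e e0; rewrite addr0.
have e40 : 0 < e / 4 by rewrite divr_gt0.
have [K1 [U1 [cK1 oU1 K1A AU1 H1]]] := separating_approx r1 i1 mA e40.
have [K2 [U2 [cK2 oU2 K2A AU2 H2]]] := separating_approx r2 i2 mA e40.
pose N1 := (\int[mu1]_g `|f1 g|)%R; pose N2 := (\int[mu2]_g `|f2 g|)%R.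
have N10 : 0 <= N1 by apply: Rintegral_ge0.
have N20 : 0 <= N2 by apply: Rintegral_ge0.
have N0 : 0 < N1 + N2 + 1 by rewrite ltr_wpDl// addr_ge0.
pose d := e / 2 / (N1 + N2 + 1).
have d0 : 0 < d by rewrite !divr_gt0.
have dN : d * N1 + d * N2 <= e / 2.
  rewrite -mulrDr /d mulrAC ler_pdivrMr// ler_wpM2l ?divr_ge0 ?ltW//.
  by rewrite ltrDl.
have KU : K1 `|` K2 `<=` U1 `&` U2.
  by move=> g [/K1A|/K2A] Ag; split; [exact: AU1|exact: AU2|exact: AU1|exact: AU2].
have [F tF sF] := separated_compact (compactU cK1 cK2) (openI oU1 oU2) KU d0.
have {}H1 := H1 d F d0 tF (separatingS (@subsetUl _ K1 K2) (@subIsetl _ U1 U2) sF).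
have {}H2 := H2 d F d0 tF (separatingS (@subsetUr _ K1 K2) (@subIsetr _ U1 U2) sF).
rewrite -/N1 (eqF F tF) in H1; rewrite -/N2 in H2.
set I := (\int[mu2]_g (F g * f2 g))%R in H1 H2.
set a := (\int[mu1]_(g in A) f1 g)%R in H1 *.
set b := (\int[mu2]_(g in A) f2 g)%R in H2 *.
move: H1 H2; rewrite !ler_norml => /andP[? ?] /andP[? ?].
by apply/andP; split; lra.
Qed.

End uniqueness.

(** * Orthogonality of the characters *)

Section haar.
Context {R : realType} {G : zmodType}.
Local Notation Gamma := (dual_group R G).
Variables (lambda : probability Gamma R) (lambda_haar : haar lambda).

Lemma measurable_dual_mul (a : Gamma) : measurable_fun setT (dual_mul a).
Proof.
apply: (measurability _ (erefl : measurable = <<s @open Gamma >>)).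
move=> _ [U oU <-]; rewrite setTI; apply: open_measurable_dual.
apply: open_comp => // g _.
apply: (cvg_dual (@fmap_filter _ _ (dual_mul a) _ (nbhs_filter g))) => x.
apply: (@cvgM R[i]); first exact: cvg_cst.
exact: continuous_echar.
Qed.

Lemma dual_invD (a : Gamma) : {morph (fun x => (a x)^-1) : x y / x + y >-> x * y}.
Proof. by move=> x y; rewrite dual_funD invfM. Qed.

Lemma dual_inv_norm (a : Gamma) x : `|(a x)^-1| = 1.
Proof. by rewrite normfV dual_fun_norm invr1. Qed.

Definition dual_inv (a : Gamma) : Gamma := DualGroup (dual_invD a) (dual_inv_norm a).

Lemma dual_fun_neq0 (a : Gamma) x : a x != 0.
Proof. by rewrite -normr_eq0 dual_fun_norm oner_eq0. Qed.

Lemma haar_preimage (a : Gamma) (A : set Gamma) : measurable A ->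
  lambda (dual_mul a @^-1` A) = lambda A.
Proof.
move=> mA; rewrite -[RHS](lambda_haar.2 (dual_inv a) A mA); congr (lambda _).
apply/seteqP; split=> [g Ag|_ [g Ag <-]].
  exists (dual_mul a g) => //; apply: dual_group_ext => x /=.
  by rewrite mulKf// dual_fun_neq0.
rewrite /preimage/= (_ : dual_mul a _ = g)//.
by apply: dual_group_ext => x /=; rewrite mulVKf// dual_fun_neq0.
Qed.

Lemma haar_integral (a : Gamma) (F : Gamma -> R) : real_trig F ->
  (\int[lambda]_g F (dual_mul a g))%R = (\int[lambda]_g F g)%R.
Proof.
move=> tF; rewrite /Rintegral; congr fine.
have mF : measurable_fun setT (EFin \o F).
  by apply/measurable_EFinP; exact: measurable_real_trig.
have [M FM] := real_trig_bounded tF.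
have := @integral_pushforward _ _ _ _ R (dual_mul a) (measurable_dual_mul a) lambda
  setT (EFin \o F) mF _ measurableT.
rewrite preimage_setT => <-.
  apply: eq_measure_integral => [|mf A mA _]; first exact: measurable_dual_mul.
  exact: haar_preimage.
apply: (le_integrable measurableT (g := EFin \o cst M)).
- exact: (measurableT_comp mF (measurable_dual_mul a)).
- move=> g _ /=; rewrite lee_fin.
  by rewrite (le_trans (FM _))// ler_norm.
- exact: finite_measure_integrable_cst.
Qed.

(** Translation by a1 multiplies e_x by a1 x, so the integral of b e_x is also
    that of b (a1 x) e_x. For b = a / (1 - a1 x), the difference of the two
    integrands is a e_x. *)
Lemma haar_orthogonal (a1 : Gamma) (x : G) (a : R[i]) : a1 x != 1 ->
  (\int[lambda]_g Re (a * g x))%R = 0.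
Proof.
move=> a1x; pose b := a / (1 - a1 x).
have n0 : 1 - a1 x != 0 by rewrite subr_eq0 eq_sym.
have int c : lambda.-integrable setT (EFin \o (fun g : Gamma => Re (c * g x))).
  have := integrable_real_trigM (finite_measure_integrable_cst lambda 1 measurableT)
    (real_trig_char c x).
  by apply: eq_integrable => // g _ /=; rewrite mulr1.
transitivity (\int[lambda]_g (Re (b * g x) - Re (b * a1 x * g x))).
  apply: eq_Rintegral => g _; rewrite -raddfB/= -mulrBl; congr (Re (_ * _)).
  by rewrite -[X in X - _]mulr1 -mulrBr /b divfK.
rewrite RintegralB// -(haar_integral a1 (real_trig_char b x)) /=.
apply/eqP; rewrite subr_eq0; apply/eqP.
by apply: eq_Rintegral => g _; rewrite mulrA.
Qed.

End haar.

(** * Almost everywhere convergence *)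

Section almost_everywhere_lemmas.
Context d {T : measurableType d} {R : realType}.
Implicit Types (mu nu : {measure set T -> \bar R}).

Lemma ae_dominates mu nu (P : T -> Prop) : mu `<< nu ->
  {ae nu, forall x, P x} -> {ae mu, forall x, P x}.
Proof.
move=> /null_content_dominatesP dom [A [mA A0 sub]].
by exists A; split=> //; exact: dom.
Qed.

Lemma ae_eventually_notin mu (F : nat -> set T) :
  (forall j, measurable (F j)) -> (forall j, (mu (F j) <= (2 ^- j.+1)%:E)%E) ->
  {ae mu, forall x, \forall j \near \oo, ~ F j x}.
Proof.
move=> mF sF.
have h := @cvg_geometric_eseries_half R 1 0.
have F0 : mu (lim_sup_set F) = 0%E.
  apply: lim_sup_set_cvg0 => //.
  apply: (@le_lt_trans _ _ (1 / 2 ^+ 0)%:E); last by rewrite ltry.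
  rewrite -(cvg_lim _ h)//; apply: lee_lim.
  - exact: is_cvg_ereal_nneg_natsum_cond.
  - by apply/cvg_ex; eexists; exact: h.
  - apply: nearW => n; apply: lee_sum => i _.
    by rewrite (le_trans (sF i))// addn1 div1r natrX.
exists (lim_sup_set F); split=> //.
  by apply: bigcap_measurable => // k _; exact: bigcup_measurable.
move=> x /= nx n _; apply: contrapT => nF; apply: nx.
by exists n => // j /= nj Fj; apply: nF; exists j.
Qed.

(** Convergence in measure, along a sequence that is fast enough for the
    Borel-Cantelli lemma. *)
Lemma ae_cvg0 mu (f : nat -> T -> R) : (forall j x, 0 <= f j x) ->
  (forall j, measurable_fun setT (f j)) ->
  (forall j, (mu [set x | (j.+1%:R^-1 <= f j x)%R] <= (2 ^- j.+1)%:E)%E) ->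
  {ae mu, forall x, f j x @[j --> \oo] --> 0}.
Proof.
move=> f0 mf sf.
have mF j : measurable [set x | j.+1%:R^-1 <= f j x].
  have := mf j measurableT _ (@measurable_itv R `[j.+1%:R^-1, +oo[).
  rewrite setTI; congr measurable; apply/seteqP.
  by split=> x /=; rewrite in_itv/= andbT.
apply: filterS (ae_eventually_notin mF sf) => x xF.
have := @cvg_harmonic R; move/cvgrPdist_lt => h.
apply/cvgrPdist_lt => e /h; apply: filterS2 xF => j /= /negP.
rewrite -ltNge !sub0r !normrN ger0_norm// ger0_norm//.
exact: lt_trans.
Qed.

End almost_everywhere_lemmas.

(** * Minimality and the Haar measure *)

Section minimality.
Context {R : realType} {G : zmodType}.
Local Notation Gamma := (dual_group R G).
Variables (lambda : probability Gamma R) (lambda_haar : haar lambda).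
Variables (p : R) (p1 : 1 < p).
Local Notation S := [set x : G | x != 0].
Implicit Types (mu : {finite_measure set Gamma -> \bar R}) (phi : Gamma -> R[i]).

(** The density with respect to mu of the real part of the functional that
    vanishes on the subspace and takes the value [dist_p mu p S] at 1. *)
Definition extremal phi (g : Gamma) : R := grad p (1 - phi g) 1.

Lemma integrable_extremal mu phi : metric_projection mu p S phi ->
  mu.-integrable setT (EFin \o extremal phi).
Proof.
move=> [[lphi _] _]; apply: (integrable_grad p1 (f := fun g => 1 - phi g)).
  by apply: in_LpB => //; exact: in_Lp_cst.
exact: in_Lp_cst.
Qed.

Lemma dist_p_ge0 mu : (0 <= dist_p mu p S)%E.
Proof.
apply: le_ereal_inf_tmp => _ [tau _ <-]; apply: integral_ge0 => x _.
by rewrite lee_fin powR_ge0.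
Qed.

Lemma dist_p_fin_num mu phi : metric_projection mu p S phi ->
  dist_p mu p S \is a fin_num.
Proof.
move=> [[lphi _] <-]; apply: integrable_fin_num => //.
by apply: integrable_pth => //; apply: in_LpB => //; exact: in_Lp_cst.
Qed.

Hypothesis separates : forall x : G, x != 0 -> exists a : Gamma, a x != 1.

(** The functional kills every character but the trivial one, on which it takes
    the value [dist_p mu p S]. So its Fourier coefficients are those of a
    multiple of the Haar measure. *)
Lemma extremal_haar mu phi (A : set Gamma) : regular_measure mu ->
  metric_projection mu p S phi -> measurable A ->
  (\int[mu]_(g in A) extremal phi g)%R = fine (dist_p mu p S) * fine (lambda A).
Proof.
move=> reg mphi mA; set D := fine _.
have ie := integrable_extremal mphi.
have ic : lambda.-integrable setT (EFin \o cst D) by exact: finite_measure_integrable_cst.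
rewrite -(Rintegral_cst lambda mA D).
apply: (fourier_uniqueness reg lambda_haar.1 ie ic) => // F; elim=> [a x|F1 F2 t1 IH1 t2 IH2].
  have iF : lambda.-integrable setT (EFin \o (fun g : Gamma => Re (a * g x))).
    have := integrable_real_trigM (finite_measure_integrable_cst lambda 1 measurableT)
      (real_trig_char a x).
    by apply: eq_integrable => // g _ /=; rewrite mulr1.
  rewrite RintegralZr//.
  have [->|x0] := eqVneq x 0.
    under eq_Rintegral do rewrite dual_fun0 mulr1.
    rewrite RintegralZl//.
    under [in RHS]eq_Rintegral do rewrite dual_fun0 mulr1.
    rewrite Rintegral_cst// [X in fine X]probability_setT/= mulr1.
    by congr (_ * _); rewrite /D -(integral_grad1 p1 mphi).
  have [a1 a1x] := separates x0.
  rewrite (haar_orthogonal lambda_haar a a1x) mul0r.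
  have Nx0 : - x != 0 by rewrite oppr_eq0.
  have h1 := integral_grad_eq0 p1 mphi (Lp_closure_trig_poly mu p1 (trig_poly_echar a (x0 : S x))).
  have h2 := integral_grad_eq0 p1 mphi
    (Lp_closure_trig_poly mu p1 (trig_poly_echar (conjc a) (Nx0 : S (- x)))).
  have lp (c : R[i]) (y : G) : S y -> mu.-integrable setT
      (EFin \o (fun g => grad p (1 - phi g) (c * g y))).
    move=> Sy; apply: (integrable_grad p1 (f := fun g => 1 - phi g)).
      by apply: in_LpB => //; [exact: in_Lp_cst|case: mphi => -[]].
    by apply: in_Lp_trig_poly => //; exact: trig_poly_echar Sy.
  (* Only the sum over x and - x involves the real part of 1 - phi alone. *)
  transitivity (\int[mu]_g (2^-1 * (grad p (1 - phi g) (a * g x) +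
      grad p (1 - phi g) (conjc a * g (- x))))).
    apply: eq_Rintegral => g _; rewrite /extremal /grad dual_funN /cdot.
    have -> : conjc a * conjc (g x) = conjc (a * g x) by rewrite rmorphM.
    by case: (1 - phi g) (a * g x) => z z' [b b'] /=; field.
  rewrite RintegralZl//; last first.
    rewrite (_ : _ \o _ = (fun g => (grad p (1 - phi g)%R (a * g x)%R)%:E +
      (grad p (1 - phi g)%R (conjc a * g (- x)%R)%R)%:E)%E)//.
    by apply: integrableD => //; exact: lp.
  rewrite RintegralD//; [|exact: lp..].
  by rewrite /Rintegral h1 h2 /= addr0 mulr0.
have sum (m : {finite_measure set Gamma -> \bar R}) f :
    m.-integrable setT (EFin \o f) ->
    \int[m]_g ((F1 g + F2 g) * f g) =
    \int[m]_g (F1 g * f g) + \int[m]_g (F2 g * f g).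
  move=> fi; rewrite -RintegralD//; try exact: integrable_real_trigM.
  by apply: eq_Rintegral => g _; rewrite mulrDl.
by rewrite sum// IH1 IH2 -(sum lambda (cst D)).
Qed.

Section common_density.
Variable nu : {finite_measure set Gamma -> \bar R}.

(** By [extremal_haar], the density with respect to nu of the Haar measure
    multiplied by [dist_p mu p S]. *)
Definition ext_density mu phi (g : Gamma) : R :=
  extremal phi g * fine (rn_derivative mu nu g).

Lemma ext_densityE mu phi : mu `<< nu ->
  (fun g => (extremal phi g)%:E * rn_derivative mu nu g)%E =
  EFin \o ext_density mu phi.
Proof.
move=> munu; apply/funext => g; rewrite /= /ext_density [RHS]EFinM fineK//.
exact: Radon_Nikodym_fin_num.
Qed.

Lemma measurable_extremal mu phi : metric_projection mu p S phi ->
  measurable_fun setT (extremal phi).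
Proof. by move=> /integrable_extremal ie; apply/measurable_EFinP; exact: measurable_int ie. Qed.

Lemma measurable_ext_density mu phi : mu `<< nu -> metric_projection mu p S phi ->
  measurable_fun setT (ext_density mu phi).
Proof.
move=> munu mphi; apply/measurable_EFinP; rewrite -[X in measurable_fun _ X]ext_densityE//.
apply: emeasurable_funM; first by apply/measurable_EFinP; exact: measurable_extremal mphi.
by apply: (measurable_int nu); exact: Radon_Nikodym_integrable.
Qed.

Lemma integral_ext_density mu phi (A : set Gamma) : mu `<< nu ->
  regular_measure mu -> metric_projection mu p S phi -> measurable A ->
  (\int[nu]_(g in A) (ext_density mu phi g)%:E =
   (fine (dist_p mu p S))%:E * lambda A)%E.
Proof.
move=> munu reg mphi mA.
have ie := integrable_extremal mphi.
have iA : mu.-integrable A (EFin \o extremal phi).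
  exact: (integrableS measurableT mA (@subsetT _ _) ie).
rewrite -[X in (\int[nu]_(g in A) X g)%E = _]/(EFin \o ext_density mu phi).
rewrite -ext_densityE// (Radon_Nikodym_change_of_variables munu mA iA).
rewrite -(fineK (integrable_fin_num mA iA)).
rewrite [X in X%:E](extremal_haar reg mphi mA) EFinM; congr (_ * _)%E.
by rewrite fineK//; exact: fin_num_measure.
Qed.

(** On its zero set the density integrates to 0, so a nonzero multiple of lambda
    vanishes there, and mu0 is dominated by lambda. *)
Lemma ext_density_neq0 mu0 mu phi : mu0 `<< lambda -> mu `<< nu ->
  regular_measure mu -> metric_projection mu p S phi ->
  fine (dist_p mu p S) != 0 ->
  {ae mu0, forall g, ext_density mu phi g != 0}.
Proof.
move=> mu0l munu reg mphi D0.
have mA : measurable [set g | ext_density mu phi g = 0].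
  have := measurable_ext_density munu mphi measurableT (measurable_set1 0).
  by rewrite setTI.
exists [set g | ext_density mu phi g = 0]; split=> //; last first.
  by move=> g /= /negP; rewrite negbK => /eqP.
apply: (null_content_dominatesP mu0 lambda).1 => //.
have := integral_ext_density munu reg mphi mA.
rewrite (eq_integral (cst 0%E)); last by move=> g; rewrite inE /= => ->.
rewrite integral0 => /esym/eqP; rewrite mule_eq0 => /orP[|/eqP//].
by rewrite eqe (negbTE D0).
Qed.

(** Both sides are densities of one and the same multiple of lambda. *)
Lemma ext_density_proportional mu1 mu2 phi1 phi2 : mu1 `<< nu -> mu2 `<< nu ->
  regular_measure mu1 -> regular_measure mu2 ->
  metric_projection mu1 p S phi1 -> metric_projection mu2 p S phi2 ->
  {ae nu, forall g, fine (dist_p mu2 p S) * ext_density mu1 phi1 g =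
                    fine (dist_p mu1 p S) * ext_density mu2 phi2 g}.
Proof.
move=> d1 d2 r1 r2 m1 m2.
have int mu phi : mu `<< nu -> metric_projection mu p S phi ->
    nu.-integrable setT (EFin \o ext_density mu phi).
  move=> munu mphi.
  apply/integrableP; split.
    by apply/measurable_EFinP; exact: measurable_ext_density.
  have ie := integrable_norm (integrable_extremal mphi).
  (* The Radon-Nikodym derivative is that of a charge, so it is nonnegative only
     almost everywhere. *)
  have v0 : {ae nu, forall g, (0 <= rn_derivative mu nu g)%E}.
    have := ae_eq_Radon_Nikodym_SigmaFinite munu measurableT.
    apply: filterS => g /(_ I); rewrite /rn_derivative => <-.
    exact: Radon_Nikodym_SigmaFinite.f_ge0.
  rewrite (ae_eq_integral (fun g => (`|extremal phi g|%:E * rn_derivative mu nu g)%E))//.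
  - rewrite (Radon_Nikodym_change_of_variables munu measurableT ie).
    exact: (integrable_lty measurableT ie).
  - apply: measurableT_comp => //; apply/measurable_EFinP.
    exact: measurable_ext_density.
  - apply: emeasurable_funM; first exact: (measurable_int _ ie).
    by apply: (measurable_int nu); exact: Radon_Nikodym_integrable.
  - apply: filterS v0 => g v0 _.
    rewrite -(ext_densityE phi munu) abseM; congr (_ * _)%E.
    exact: gee0_abs.
set D1 := fine (dist_p mu1 p S); set D2 := fine (dist_p mu2 p S).
have intA mu phi (A : set Gamma) : mu `<< nu -> metric_projection mu p S phi ->
    measurable A -> nu.-integrable A (EFin \o ext_density mu phi).
  by move=> ? ? mA; apply: (integrableS measurableT mA (@subsetT _ _)); exact: int.
have := @integral_ae_eq _ _ _ nu setT measurableT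
  (fun g => (D1%:E * (ext_density mu2 phi2 g)%:E)%E)
  (fun g => (D2%:E * (ext_density mu1 phi1 g)%:E)%E) _ _ _.
move=> /(_ _ _ _)/filterS; apply.
- by move=> g /= /(_ I); rewrite -!EFinM => -[].
- by apply: integrableZl => //; exact: int.
- by apply: measurable_int; apply: integrableZl => //; exact: int.
move=> A _ mA; rewrite !integralZl//; try exact: intA.
by rewrite !integral_ext_density// muleCA.
Qed.

End common_density.
End minimality.

(** * Convergence of the distances *)

Section convergence.
Context {R : realType} {G : zmodType}.
Local Notation Gamma := (dual_group R G).
Variables (p : R) (p1 : 1 < p).

Lemma pth_integral_markov (mu : {finite_measure set Gamma -> \bar R})
    (f : Gamma -> R[i]) (a : R) : cmeasurable f -> 0 < a ->
  ((a `^ p)%:E * mu [set x | (a <= normc (f x))%R] <= pth_integral mu p f)%E.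
Proof.
move=> mf a0.
set A := [set x | _]; have mA : measurable A.
  have := measurable_normc mf measurableT (@measurable_itv R `[a, +oo[).
  rewrite setTI; congr measurable; apply/seteqP.
  by split=> x /=; rewrite in_itv/= andbT.
rewrite -integral_cst//.
apply: (@le_trans _ _ (\int[mu]_(x in A) (normc (f x) `^ p)%:E)%E).
  apply: ge0_le_integral => //.
  - by move=> x _; rewrite lee_fin powR_ge0.
  - by apply/measurable_EFinP; apply: measurable_funTS; exact: measurable_normc_powR.
  - move=> x /= ax; rewrite lee_fin ge0_ler_powR ?nnegrE ?normc_ge0//.
      by rewrite ltW// (lt_trans ltr01).
    exact: ltW.
apply: ge0_subset_integral => //.
  by apply/measurable_EFinP; exact: measurable_normc_powR.
by move=> x _; rewrite lee_fin powR_ge0.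
Qed.

Lemma cvg_pth_integral_in_measure (mu : {finite_measure set Gamma -> \bar R})
    (f : nat -> Gamma -> R[i]) (a : R) : (forall n, cmeasurable (f n)) -> 0 < a ->
  pth_integral mu p (f n) @[n --> \oo] --> 0%E ->
  mu [set x | a <= normc (f n x)] @[n --> \oo] --> 0%E.
Proof.
move=> mf a0 cv.
have ap : 0 < a `^ p by rewrite powR_gt0.
apply: (@squeeze_cvge _ _ _ _ (cst 0%E) _
  (fun n => ((a `^ p)^-1%:E * pth_integral mu p (f n))%E)).
- apply: nearW => n; rewrite measure_ge0/=.
  rewrite lee_pdivlMl//; exact: pth_integral_markov.
- exact: cvg_cst.
- by rewrite -(mule0 (a `^ p)^-1%:E); apply: cvgeZl.
Qed.

Lemma cvg0_eventually_le (u : nat -> \bar R) (a : R) : 0 < a ->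
  u n @[n --> \oo] --> 0%E -> \forall n \near \oo, (u n <= a%:E)%E.
Proof.
move=> a0 /fine_cvgP[fin /cvgrPdist_lt/(_ _ a0)]; apply: filterS2 fin => n fin.
rewrite /= sub0r normrN -(fineK fin) lee_fin => h.
exact/ltW/(le_lt_trans (ler_norm _)).
Qed.

(** The character e_x is the constant 1, so T(S) contains 1. *)
Lemma dist_p_eq0 (mu : {finite_measure set Gamma -> \bar R}) (x : G) : x != 0 ->
  (forall a : Gamma, a x = 1) -> dist_p mu p [set x | x != 0] = 0%E.
Proof.
move=> x0 ax; apply/eqP; rewrite eq_le dist_p_ge0 andbT.
apply: ereal_inf_lbound; exists (fun g : Gamma => 1 * g x); first exact: trig_poly_echar.
rewrite /pth_integral -[RHS](integral0 mu setT); apply: eq_integral => g _.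
by rewrite ax mulr1 subrr ComplexField.Normc.normc0 powR0// gt_eqF// (lt_trans ltr01).
Qed.

End convergence.

Section separated_points.
Context {R : realType} {G : zmodType}.
Local Notation Gamma := (dual_group R G).
Local Notation S := [set x : G | x != 0].
Variables (lambda : probability Gamma R) (lambda_haar : haar lambda).
Variables (p : R) (p1 : 1 < p).
Hypothesis separates : forall x : G, x != 0 -> exists a : Gamma, a x != 1.
Variables (mu0 : {finite_measure set Gamma -> \bar R})
  (mu : nat -> {finite_measure set Gamma -> \bar R}).
Hypotheses (mu0_M : in_M mu0) (mu_M : forall n, in_M (mu n)).
Hypothesis mu0_ac : mu0 `<< lambda.
Variables (phi0 : Gamma -> R[i]) (phi : nat -> Gamma -> R[i]).
Hypotheses (phi0_proj : metric_projection mu0 p S phi0)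
  (phi_proj : forall n, metric_projection (mu n) p S (phi n)).

Lemma cvg_dist_p_separated : m_lim mu mu0 ->
  pth_integral mu0 p (fun g => phi0 g - phi n g) @[n --> \oo] --> 0%E ->
  dist_p (mu n) p S @[n --> \oo] --> dist_p mu0 p S.
Proof.
move=> [nu [nuM mu0nu munu mcv]] pcv.
have [mu0T r0] := mu0_M; have r n := (mu_M n).2.
rewrite -(fineK (dist_p_fin_num p1 phi0_proj)).
set D0 := fine _; pose D n := fine (dist_p (mu n) p S).
rewrite (_ : (fun n => _) = (fun n => (D n)%:E)); last first.
  by apply/funext => n; rewrite fineK// (dist_p_fin_num p1 (phi_proj n)).
suff : D n @[n --> \oo] --> D0 by move=> h; apply: cvg_EFin => //; exact: nearW.
apply: contrapT => ncv.
have [e e0 far] : exists2 e : R, 0 < e & ~ \forall n \near \oo, `|D0 - D n| < e.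
  apply: contrapT => h; apply: ncv; apply/cvgrPdist_lt => e e0.
  by apply: contrapT => h'; apply: h; exists e.
pose v n := rn_derivative (mu n) nu; pose v0 := rn_derivative mu0 nu.
pose a n g := normc (phi0 g - phi n g).
pose b n g := `|fine (v n g) - fine (v0 g)|.
have mphi0 : cmeasurable phi0 by case: phi0_proj => -[[]].
have mphi n : cmeasurable (phi n) by case: (phi_proj n) => -[[]].
have ma n : measurable_fun setT (a n) by apply: measurable_normc; exact: cmeasurableB.
have mrn (m : {finite_measure set Gamma -> \bar R}) : m `<< nu -> measurable_fun setT (fun g => fine (rn_derivative m nu g)).
  move=> mnu; apply: measurableT_comp => //.
  by apply: (measurable_int nu); exact: Radon_Nikodym_integrable.
have mb n : measurable_fun setT (b n).
  by apply: measurableT_comp => //; apply: measurable_funB; exact: mrn.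
have bE n g : (`|v n g - v0 g|)%E = (b n g)%:E.
  have fn : v n g \is a fin_num by apply: Radon_Nikodym_fin_num; exact: munu.
  have f0 : v0 g \is a fin_num by exact: Radon_Nikodym_fin_num.
  by rewrite -(fineK fn) -(fineK f0) -EFinB abse_EFin.
(* The bounds on the measures are summable over j, so that [ae_cvg0] applies to
   any choice of close indices. *)
pose close j n := [/\ e <= `|D0 - D n|,
  (mu0 [set g | (j.+1%:R^-1 <= a n g)%R] <= (2 ^- j.+1)%:E)%E &
  (nu [set g | (j.+1%:R^-1 <= b n g)%R] <= (2 ^- j.+1)%:E)%E].
have /choice[s sP] : forall j, exists n, close j n.
  move=> j.
  have j0 : 0 < j.+1%:R^-1 :> R by rewrite invr_gt0.
  have h0 : 0 < 2 ^- j.+1 :> R by rewrite invr_gt0 exprn_gt0.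
  have A1 := cvg0_eventually_le h0 (cvg_pth_integral_in_measure p1
    (fun n => cmeasurableB mphi0 (mphi n)) j0 pcv).
  have A2 := cvg0_eventually_le h0 (mcv _ j0).
  apply: contrapT => /forallNP none; apply: far.
  apply: filterS2 A1 A2 => n h1 h2; rewrite ltNge; apply/negP => h3.
  apply: (none n); split=> //; apply: le_trans h2.
  rewrite le_eqVlt; apply/orP; left; apply/eqP; congr (nu _).
  by apply/seteqP; split=> g /=; rewrite bE lee_fin.
have cva : {ae mu0, forall g, a (s j) g @[j --> \oo] --> 0}.
  by apply: ae_cvg0 => // [j g|j]; [exact: normc_ge0|have [] := sP j].
have cvb : {ae mu0, forall g, b (s j) g @[j --> \oo] --> 0}.
  apply: (ae_dominates mu0nu); apply: ae_cvg0 => [j g|//|j].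
    exact: normr_ge0.
  by have [] := sP j.
(* The distances differ from D0, so they are not all zero together with D0; a
   measure at positive distance serves as a yardstick for the others. *)
have [m [psi [mnu rm mpsi Dm]]] : exists (m : {finite_measure set Gamma -> \bar R}) psi,
    [/\ m `<< nu, regular_measure m, metric_projection m p S psi &
        fine (dist_p m p S) != 0].
  have [D00|D00] := eqVneq D0 0; last by exists mu0, phi0.
  exists (mu (s 0%N)), (phi (s 0%N)); split=> //; apply/eqP => D10.
  have [] := sP 0%N; rewrite D00 /D D10 subrr normr0 => h _ _.
  by move: h; rewrite leNgt e0.
pose k m phi g := ext_density p nu m phi g.
have kN0 : {ae mu0, forall g, k m psi g != 0}.
  exact: (ext_density_neq0 lambda_haar p1 separates mu0_ac mnu rm mpsi Dm).
have prop : {ae mu0, forall g n, D n * k m psi g =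
    fine (dist_p m p S) * k (mu n) (phi n) g}.
  apply/ae_foralln => n; apply: (ae_dominates mu0nu).
  exact: (ext_density_proportional lambda_haar p1 separates).
have prop0 : {ae mu0, forall g, D0 * k m psi g =
    fine (dist_p m p S) * k mu0 phi0 g}.
  apply: (ae_dominates mu0nu).
  exact: (ext_density_proportional lambda_haar p1 separates).
have PF : ProperFilter (almost_everywhere mu0).
  by apply: ae_properfilter_algebraOfSetsType; rewrite lt0e mu0T measure_ge0.
have [g [ga [gb [gk [gp gp0]]]]] := @filter_ex _ _ PF _
  (filterI cva (filterI cvb (filterI kN0 (filterI prop prop0)))).
have cvk : k (mu (s j)) (phi (s j)) g @[j --> \oo] --> k mu0 phi0 g.
  apply: cvgM.
    apply: (cvg_grad p1 (z := fun j => 1 - phi (s j) g)).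
    rewrite (_ : (fun j => _) = (fun j => a (s j) g))//.
    by apply/funext => j; rewrite opprB addrC addrA subrK.
  apply/cvgrPdist_lt => d d0; move/cvgrPdist_lt/(_ _ d0) : gb.
  by apply: filterS => j; rewrite sub0r normrN normr_id distrC.
have cvD : D (s j) @[j --> \oo] --> D0.
  rewrite (_ : D0 = fine (dist_p m p S) * k mu0 phi0 g / k m psi g); last first.
    by rewrite -gp0 mulfK.
  rewrite (_ : (fun j => _) = (fun j => fine (dist_p m p S) *
    k (mu (s j)) (phi (s j)) g / k m psi g)).
    by apply: cvgM; [apply: cvgM => //; exact: cvg_cst|exact: cvg_cst].
  by apply/funext => j; rewrite -gp mulfK.
have /cvgrPdist_lt/(_ _ e0)[j _ /(_ j (leqnn j))/=] := cvD.
by have [h _ _] := sP j; rewrite ltNge h.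
Qed.

End separated_points.

Theorem corollary4p8 (R : realType) (G : zmodType)
    (G_neq0 : exists x : G, x != 0)
    (lambda : probability (dual_group R G) R) (lambda_haar : haar lambda)
    (p : R) (p_gt1 : 1 < p)
    (mu0 : {finite_measure set (dual_group R G) -> \bar R})
    (mu : nat -> {finite_measure set (dual_group R G) -> \bar R})
    (mu0_M : in_M mu0) (mu_M : forall n, in_M (mu n))
    (mu0_ac : mu0 `<< lambda) (mu_ac : forall n, mu n `<< lambda)
    (mu0_mu : forall n, mu0 `<< mu n)
    (mu_lim : m_lim mu mu0)
    (phi0 : dual_group R G -> R[i]) (phi : nat -> dual_group R G -> R[i])
    (phi0_proj : metric_projection mu0 p [set x : G | x != 0] phi0)
    (phi_proj : forall n, metric_projection (mu n) p [set x : G | x != 0] (phi n))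
    (phi_lim : pth_integral mu0 p (fun gamma => phi0 gamma - phi n gamma)
                 @[n --> \oo] --> 0%E) :
  dist_p (mu n) p [set x : G | x != 0] @[n --> \oo]
    --> dist_p mu0 p [set x : G | x != 0].
Proof.
have [[x [x0 ax]]|sep] := pselect (exists x : G, x != 0 /\
    forall a : dual_group R G, a x = 1).
  rewrite (dist_p_eq0 p_gt1 mu0 x0 ax).
  by under eq_fun do rewrite (dist_p_eq0 p_gt1 _ x0 ax); exact: cvg_cst.
apply: (cvg_dist_p_separated lambda_haar p_gt1 _ mu0_M mu_M mu0_ac
  phi0_proj phi_proj mu_lim phi_lim) => x x0.
apply: contrapT => /forallNP h; apply: sep; exists x; split=> // a.
by have /negP := h a; rewrite negbK => /eqP.
Qed.
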